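(* Let $\lambda\in\mathbb{N}_0^m$, $\alpha\in\mathbb{N}_0^l$, and let $T:V(\lambda)\to V(\alpha)$ be a $\mathbb{C}$-linear operator which restricts to a real linear operator from $V_{\mathbb{R}}(\lambda)$ to $V_{\mathbb{R}}(\alpha)$. The following are equivalent. (i) $T$ preserves strong real stability, i.e., for every real stable $p\in V_{\mathbb{R}}(\lambda)$, $T(p)$ is nonzero and real stable. (ii) $\operatorname{Symb}(T)$ is either $(\overline{\mathcal{H}_-}^{\,m}\times\mathcal{H}_+^{\,l})$-stable or $(\overline{\mathcal{H}_-}^{\,m}\times\mathcal{H}_-^{\,l})$-stable.
   Context: For $\lambda\in\mathbb{N}_0^m$, $V(\lambda)$ (resp. $V_{\mathbb{R}}(\lambda)$) is the complex (resp. real) vector space of polynomials $p(x_1,y_1,\dots,x_m,y_m)$ with complex (resp. real) coefficients that are homogeneous of degree $\lambda_k$ in the pair $(x_k,y_k)$ for each $k$. Points of $\mathbb{CP}^1$ are written $(a:b)$ and identified with the Riemann sphere $\mathbb{C}\cup\{\infty\}$ via $a/b$. Zeros of $p\in V(\lambda)$ are considered in $(\mathbb{CP}^1)^m$. For $\Omega\subseteq(\mathbb{CP}^1)^m$, $p$ is $\Omega$-stable if it has no zero in $\Omega$. $\mathcal{H}_+,\mathcal{H}_-$ are the open upper and lower half-planes in $\mathbb{C}\subset\mathbb{CP}^1$; $\overline{\mathcal{H}_-}$ is the closure in $\mathbb{CP}^1$ (so it contains $\mathbb{R}\cup\{\infty\}$). A polynomial $p\in V_{\mathbb{R}}(\lambda)$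 is real stable if it is $\mathcal{H}_+^m$-stable. Symbol: $\operatorname{Symb}(T):=T[(zy-xw)^\lambda]=\sum_{\mu\le\lambda}\binom{\lambda}{\mu}z^{\lambda-\mu}(-w)^\mu\,T(x^\mu y^{\lambda-\mu})\in V(\lambda\sqcup\alpha)$ (multi-index notation, $(zy-xw)^\lambda=\prod_k(z_ky_k-x_kw_k)^{\lambda_k}$, $\lambda\sqcup\alpha=(\lambda_1,\dots,\lambda_m,\alpha_1,\dots,\alpha_l)$), where $T$ acts only on the $x,y$ variables; the pairs $(z_k,w_k)$, $k\le m$, are the first $m$ pairs of variables and the $l$ output pairs $(x_j,y_j)$ come last. *)

(* Defs.v *)
From HB Require Import structures.
From mathcomp Require Import all_boot all_order all_algebra.
From mathcomp Require Import mpoly complex.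
From mathcomp Require Import classical_sets reals topology.
From mathcomp Require Import one_point_compactification normedtype.
Set Implicit Arguments.
Unset Strict Implicit.
Unset Printing Implicit Defensive.
Import Order.TTheory GRing.Theory Num.Theory.
Import numFieldNormedType.Exports.
Local Open Scope ring_scope.
Local Open Scope complex_scope.
Local Open Scope classical_set_scope.

(* Concatenation of tuples indexed by 'I_m and 'I_l; for multi-indices this
   is lam \sqcup al. *)
Definition fcat (A : Type) m l (f : 'I_m -> A) (g : 'I_l -> A) (i : 'I_(m + l))
    : A :=
  match split i with inl k => f k | inr j => g j end.

Definition mcat m l (mu : 'X_{1..m}) (nu : 'X_{1..l}) : 'X_{1..m + l} :=
  [multinom fcat mu nu i | i < m + l].

Lemma fcat_lshift A m l (f : 'I_m -> A) (g : 'I_l -> A) k :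
  fcat f g (lshift l k) = f k.
Proof. by rewrite /fcat (unsplitK (inl k)). Qed.

Lemma fcat_rshift A m l (f : 'I_m -> A) (g : 'I_l -> A) j :
  fcat f g (rshift m j) = g j.
Proof. by rewrite /fcat (unsplitK (inr j)). Qed.

Lemma mulmnDr n (mu : 'X_{1..n}) i j : (mu *+ (i + j) = mu *+ i + mu *+ j)%MM.
Proof. by apply/mnmP => k; rewrite mnmDE !mulmnE mulnDr. Qed.

(* Polynomials in the n pairs (x_k, y_k) live in {mpoly K[n + n]}, where x_k is
   the variable of index lshift n k and y_k the one of index rshift n k. *)
Section MultiHomogeneous.
Variables (K : comNzRingType) (n : nat).
Implicit Types (lam : 'X_{1..n}) (p q : {mpoly K[n + n]}) (mu : 'X_{1..n + n}).

Definition xvar (k : 'I_n) : {mpoly K[n + n]} := 'X_(lshift n k).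
Definition yvar (k : 'I_n) : {mpoly K[n + n]} := 'X_(rshift n k).

Definition multihomog_pred lam : pred {mpoly K[n + n]} := fun p =>
  all (fun mu => [forall k : 'I_n, mu (lshift n k) + mu (rshift n k) == lam k]%N)
      (msupp p).
Arguments multihomog_pred _ _ /.
Definition multihomog lam := [qualify p | multihomog_pred lam p].

Lemma multihomogP lam p :
  reflect {in msupp p, forall mu k, (mu (lshift n k) + mu (rshift n k))%N = lam k}
          (p \is multihomog lam).
Proof.
apply: (iffP allP) => h mu /h; first by move/forallP=> hk k; apply/eqP.
by move=> hk; apply/forallP => k; apply/eqP.
Qed.

Lemma multihomog_submod_closed lam : submod_closed (multihomog lam).
Proof.
split=> [|c p q]; first by apply/multihomogP => mu; rewrite msupp0.
move=> /multihomogP hp /multihomogP hq; apply/multihomogP => mu.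
by move/msuppD_le; rewrite mem_cat => /orP[/msuppZ_le|] => [/hp|/hq].
Qed.

HB.instance Definition _ lam :=
  GRing.isSubmodClosed.Build K {mpoly K[n + n]} (multihomog_pred lam)
    (multihomog_submod_closed lam).

Lemma multihomogX lam mu :
  (forall k, (mu (lshift n k) + mu (rshift n k))%N = lam k) ->
  'X_[mu] \is multihomog lam.
Proof. by move=> h; apply/multihomogP => mu' /mem_msuppXP <-. Qed.

Lemma multihomogM lam1 lam2 p q :
  p \is multihomog lam1 -> q \is multihomog lam2 ->
  p * q \is multihomog (lam1 + lam2)%MM.
Proof.
move=> /multihomogP hp /multihomogP hq; apply/multihomogP => mu.
move/msuppM_le => /allpairsP [[m1 m2] /= [/hp h1 /hq h2 ->]] k.
by rewrite !mnmDE -h1 -h2 addnACA.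
Qed.

Lemma multihomog1 : (1 : {mpoly K[n + n]}) \is multihomog 0%MM.
Proof.
by apply/multihomogP => mu; rewrite msupp1 inE => /eqP -> k; rewrite !mnm0E.
Qed.

Lemma multihomogXn lam p e :
  p \is multihomog lam -> p ^+ e \is multihomog (lam *+ e)%MM.
Proof.
move=> hp; elim: e => [|e ih]; first by rewrite expr0 mulm0n multihomog1.
by rewrite exprS mulmS multihomogM.
Qed.

Lemma multihomog_prod (I : finType) (F : I -> {mpoly K[n + n]})
    (L : I -> 'X_{1..n}) :
  (forall i, F i \is multihomog (L i)) ->
  \prod_i F i \is multihomog (\sum_i L i)%MM.
Proof.
move=> h.
apply: (big_ind2 (fun (p : {mpoly K[n + n]}) lam => p \is multihomog lam)).
- exact: multihomog1.
- by move=> p l1 q l2; exact: multihomogM.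
- by move=> i _; exact: h.
Qed.

Lemma multihomog_xvar k : xvar k \is multihomog U_(k)%MM.
Proof.
apply: multihomogX => j.
by rewrite !mnm1E eq_lshift eq_lrshift addn0.
Qed.

Lemma multihomog_yvar k : yvar k \is multihomog U_(k)%MM.
Proof.
apply: multihomogX => j.
by rewrite !mnm1E eq_rshift eq_rlshift add0n.
Qed.

Record mhpoly lam := MHPoly {
  mhpoly_val :> {mpoly K[n + n]};
  _ : mhpoly_val \is multihomog lam }.

HB.instance Definition _ lam := [isSub for @mhpoly_val lam].
HB.instance Definition _ lam := [Choice of mhpoly lam by <:].
HB.instance Definition _ lam := [SubChoice_isSubLmodule of mhpoly lam by <:].

(* x^mu y^(lam - mu); only meaningful (and only used) for mu <= lam, where the
   default value 0 of insubd does not occur. *)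
Definition xymon lam (mu : 'X_{1..n}) : mhpoly lam :=
  insubd (0 : mhpoly lam) 'X_[mcat mu (lam - mu)%MM].

Lemma xymonE lam (mu : 'X_{1..n}) : (mu <= lam)%MM ->
  xymon lam mu = \prod_k (xvar k ^+ mu k * yvar k ^+ (lam k - mu k))
    :> {mpoly K[n + n]}.
Proof.
move=> /mnm_lepP le; rewrite /xymon insubdK.
  rewrite mpolyXE_id big_split_ord big_split /=; congr (_ * _);
    apply: eq_bigr => k _; rewrite mnmE ?fcat_lshift ?fcat_rshift //.
  by rewrite mnmBE.
by apply: multihomogX => k; rewrite !mnmE fcat_lshift fcat_rshift mnmBE subnKC.
Qed.

End MultiHomogeneous.

Section Symbol.
Variables (K : comNzRingType) (m l : nat) (lam : 'X_{1..m}) (al : 'X_{1..l}).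

(* The m + l pairs of variables of the symbol: first the (z_k, w_k), then the
   output pairs (x_j, y_j). *)
Definition zvar (k : 'I_m) : {mpoly K[(m + l) + (m + l)]} := xvar K (lshift l k).
Definition wvar (k : 'I_m) : {mpoly K[(m + l) + (m + l)]} := yvar K (lshift l k).

Definition out_vars : (l + l).-tuple {mpoly K[(m + l) + (m + l)]} :=
  [tuple fcat (fun j => xvar K (rshift m j)) (fun j => yvar K (rshift m j)) i
     | i < l + l].

Definition symb_poly (T : mhpoly K lam -> mhpoly K al)
    : {mpoly K[(m + l) + (m + l)]} :=
  \sum_(mu : 'X_{1..m < (mdeg lam).+1} | (mu <= lam)%MM)
    (\prod_k 'C(lam k, mu k))%:R *:
    (\prod_k (zvar k ^+ (lam k - mu k) * (- wvar k) ^+ mu k)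
     * (T (xymon K lam mu) \mPo out_vars)).

Lemma mcat_sum (a : 'X_{1..m}) (b : 'X_{1..l}) :
  mcat a b = (\sum_k U_(lshift l k) *+ a k + \sum_j U_(rshift m j) *+ b j)%MM.
Proof.
apply/mnmP => i; rewrite mnmE mnmDE !mnm_sumE.
under eq_bigr do rewrite mulmnE mnm1E.
under [in X in (_ + X)%N]eq_bigr do rewrite mulmnE mnm1E.
case: (split_ordP i) => k ->.
  rewrite fcat_lshift (bigD1 k) //= eqxx mul1n big1 => [|j jk].
    rewrite big1 ?addn0 // => j _; first by rewrite eq_rlshift mul0n.
  by rewrite eq_lshift (negbTE jk) mul0n.
rewrite fcat_rshift big1 => [|j _]; last by rewrite eq_lrshift mul0n.
rewrite (bigD1 k) //= eqxx mul1n big1 ?addn0 ?add0n // => j jk.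
by rewrite eq_rshift (negbTE jk) mul0n.
Qed.

Lemma symb_poly_multihomog T : symb_poly T \is multihomog K (mcat lam al).
Proof.
apply: rpred_sum => mu /mnm_lepP le; apply: rpredZ; rewrite mcat_sum.
apply: multihomogM.
  apply: multihomog_prod => k; rewrite -{2}(subnK (le k)) mulmnDr.
  apply: multihomogM; apply: multihomogXn; first exact: multihomog_xvar.
  by rewrite rpredN; exact: multihomog_yvar.
case: (T _) => p /= /multihomogP hp; rewrite comp_mpolyE.
rewrite big_seq; apply: rpred_sum => nu /hp hnu; apply: rpredZ.
rewrite big_split_ord /= -big_split /=; apply: multihomog_prod => j.
rewrite -hnu mulmnDr !tnth_mktuple fcat_lshift fcat_rshift.
apply: multihomogM; apply: multihomogXn; first exact: multihomog_xvar.
exact: multihomog_yvar.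
Qed.

Definition Symb (T : mhpoly K lam -> mhpoly K al) : mhpoly K (mcat lam al) :=
  MHPoly (symb_poly_multihomog T).

End Symbol.

(* The Riemann sphere: None is the point at infinity. *)
Definition CP1 (R : realType) : topologicalType :=
  one_point_compactification (R[i])^o.

(* The point (a : b), for (a, b) <> (0, 0). *)
Definition hpt (R : realType) (a b : R[i]) : CP1 R :=
  if b == 0 then None else Some (a / b).

Section Stability.
Variable R : realType.

Definition upper_half_plane : set (CP1 R) :=
  Some @` [set z : R[i] | 0 < complex.Im z].
Definition lower_half_plane : set (CP1 R) :=
  Some @` [set z : R[i] | complex.Im z < 0].

Definition zero_at n (lam : 'X_{1..n}) (p : mhpoly R[i] lam) (P : 'I_n -> CP1 R) :=
  exists a b : 'I_n -> R[i],
    (forall k, (a k, b k) != (0, 0) /\ hpt (a k) (b k) = P k) /\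
    (p : {mpoly _[_]}).@[fcat a b] = 0.

Lemma hpt_eq (a b c d : R[i]) : (a, b) != (0, 0) -> (c, d) != (0, 0) ->
  hpt a b = hpt c d -> exists2 t, t != 0 & c = t * a /\ d = t * b.
Proof.
rewrite /hpt !xpair_eqE; have [->|b0] := eqVneq b 0;
  have [->|d0] := eqVneq d 0; rewrite ?andbT ?andbF //=.
- move=> a0 c0 _; exists (c / a); first by rewrite mulf_neq0 ?invr_eq0.
  by rewrite mulfVK // mulr0.
- move=> _ _ [h]; exists (d / b); first by rewrite mulf_neq0 ?invr_eq0.
  by rewrite mulfVK // mulrAC -mulrA h mulrC mulfVK.
Qed.

(* Vanishing does not depend on the choice of homogeneous coordinates. *)
Lemma zero_at_hpt n (lam : 'X_{1..n}) (p : mhpoly R[i] lam)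
    (a b : 'I_n -> R[i]) : (forall k, (a k, b k) != (0, 0)) ->
  zero_at p (fun k => hpt (a k) (b k)) <->
  (p : {mpoly _[_]}).@[fcat a b] = 0.
Proof.
move=> ab0; split; last first.
  by move=> p0; exists a, b; split=> // k; split.
move=> [c [d [cd p0]]].
have tP k : {t : R[i] | t != 0 & a k = t * c k /\ b k = t * d k}.
  by apply: boolp.cid2; have [? ?] := cd k; exact: hpt_eq.
pose t k := s2val (tP k).
suff -> : (p : {mpoly _[_]}).@[fcat a b] =
    \prod_k t k ^+ lam k * (p : {mpoly _[_]}).@[fcat c d] by rewrite p0 mulr0.
case: p {p0} => p /= /multihomogP hp; rewrite !mevalE mulr_sumr [LHS]big_seq [RHS]big_seq.
apply: eq_bigr => mu /hp hmu; rewrite mulrCA; congr (_ * _).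
rewrite !big_split_ord /= -!big_split /=; apply: eq_bigr => k _.
have [ak bk] : a k = t k * c k /\ b k = t k * d k := s2valP' (tP k).
rewrite !fcat_lshift !fcat_rshift ak bk -hmu exprD !exprMn.
by rewrite mulrACA.
Qed.

Definition stable n (lam : 'X_{1..n}) (Omega : set ('I_n -> CP1 R))
    (p : mhpoly R[i] lam) : Prop :=
  forall P, Omega P -> ~ zero_at p P.

Definition set_pow n (A : set (CP1 R)) : set ('I_n -> CP1 R) :=
  [set P | forall k, A (P k)].

(* A^m x B^l *)
Definition set_pow2 m l (A B : set (CP1 R)) : set ('I_(m + l) -> CP1 R) :=
  [set P | set_pow A (fun k : 'I_m => P (lshift l k)) /\
           set_pow B (fun j : 'I_l => P (rshift m j))].

Definition is_real n (lam : 'X_{1..n}) (p : mhpoly R[i] lam) : Prop :=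
  (p : {mpoly _[_]}) \is a mpolyOver (n + n) Num.real.

Definition real_stable n (lam : 'X_{1..n}) (p : mhpoly R[i] lam) : Prop :=
  is_real p /\ stable (set_pow upper_half_plane) p.

End Stability.

Arguments upper_half_plane {R}.
Arguments lower_half_plane {R}.

(* Main.v *)
Require Import Defs.
From mathcomp Require Import all_boot all_order all_algebra.
From mathcomp Require Import mpoly complex.
From mathcomp Require Import ring lra.
From mathcomp Require Import boolp classical_sets reals topology.
From mathcomp Require Import one_point_compactification normedtype realfun.
Set Implicit Arguments.
Unset Strict Implicit.
Unset Printing Implicit Defensive.
Import Order.TTheory GRing.Theory Num.Theory.
Import numFieldNormedType.Exports.
Local Open Scope ring_scope.

(* (ii) => (i).  Fix a point X of the output half-plane; q := Symb(T)(., X) has no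
   zero on the closed lower half-planes, hence by compactness none on a product
   E^m of slightly larger closed disks, while a real stable p has no zero on C^m,
   where C is the closed disk complementary to the interior of E.  On bihomogeneous
   polynomials K(x, y, z, w) without zeros on C^m x E^m, Laguerre's theorem on polar
   derivatives, used once for C and once for E, shows that the transvectant
   d_y d_z - d_x d_w of any pair of variables again has no zeros there (this is
   where C and E must share a boundary point).  Iterated on K = p q down to a
   constant, it computes T(p)(X) up to a nonzero factor.

   (i) => (ii).  Let f_a := prod_k (z_k y_k - x_k w_k)^lam_k with a = (z : w) in
   the closed lower half-planes, so that Symb(T)(a, X) = T(f_a)(X).  If some
   relevant coordinate of a is not real, then |f_a| > |f_conj(a)| on the upper
   half-planes, so u f_a + u^* f_conj(a) is real stable for all u <> 0; hence
   |Symb(T)(a, X)| <> |Symb(T)(conj(a), X)|.  By connectedness the sign of the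
   difference of the moduli does not depend on (a, X): it decides between the two
   alternatives. *)

(** * Laguerre's theorem on polar derivatives *)

Definition upd (A : Type) n (a : 'I_n -> A) (k : 'I_n) (x : A) : 'I_n -> A :=
  fun i => if i == k then x else a i.

Section Restriction.
Variables (C : fieldType) (N : nat).
Implicit Types (F : {mpoly C[N]}) (u v : 'I_N -> C).

Definition line_poly F v u : {poly C} :=
  mmap (@polyC C) (fun i => (v i)%:P + u i *: 'X) F.

Lemma horner_line F v u s : (line_poly F v u).[s] = F.@[fun i => v i + s * u i].
Proof.
rewrite /line_poly mevalE /mmap horner_sum; apply: eq_bigr => m _.
rewrite hornerM hornerC /mmap1 horner_prod; congr (_ * _).
by apply: eq_bigr => i _; rewrite horner_exp !hornerE mulrC.
Qed.

Lemma line_polyD F G v u :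
  line_poly (F + G) v u = line_poly F v u + line_poly G v u.
Proof. exact: mmapD. Qed.

Lemma line_polyZ c F v u : line_poly (c *: F) v u = c *: line_poly F v u.
Proof. by rewrite /line_poly mmapZ mul_polyC. Qed.

Lemma line_polyX m v u :
  line_poly 'X_[m] v u = \prod_i ((v i)%:P + u i *: 'X) ^+ m i.
Proof. exact: mmapX. Qed.

Lemma deriv_line F v u :
  (line_poly F v u)^`() = \sum_i u i *: line_poly F^`M(i) v u.
Proof.
elim/mpolyind: F => [|c m F _ _ ih].
  rewrite /line_poly raddf0 deriv0 big1 // => i _.
  by rewrite mderiv0 raddf0 scaler0.
rewrite line_polyD line_polyZ derivD derivZ ih.
under [in RHS]eq_bigr do
  rewrite mderivD mderivZ line_polyD line_polyZ scalerDr scalerA mulrC -scalerA.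
rewrite big_split -scaler_sumr; congr (_ *: _ + _); rewrite line_polyX.
have deriv_bigprod (I : eqType) (r : seq I) (G : I -> {poly C}) : uniq r ->
    (\prod_(i <- r) G i)^`() = \sum_(i <- r) (G i)^`() * \prod_(j <- r | j != i) G j.
  elim: r => [|i r ihr] /=; first by rewrite !big_nil -polyC1 derivC.
  move=> /andP[ir ur]; rewrite !big_cons derivM eqxx ihr //=; congr (_ + _).
    congr (_ * _); rewrite big_seq [RHS]big_seq_cond; apply: eq_bigl => j.
    by case: (boolP (j \in r)) => //= jr; rewrite (memPn ir).
  rewrite mulr_sumr; apply: eq_big_seq => j jr.
  by rewrite big_cons (_ : i != j) 1?eq_sym ?(memPn ir) // mulrCA.
rewrite deriv_bigprod ?index_enum_uniq //; apply: eq_bigr => i _.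
rewrite mderivX line_polyZ line_polyX [in RHS](bigD1 i) //=.
rewrite deriv_exp derivD derivC derivZ derivX add0r alg_polyC.
rewrite mnmBE mnm1E eqxx subn1 scalerA mulrC -!mul_polyC polyCM -mulr_natr polyC_natr.
under [in RHS]eq_bigr => j ji do rewrite mnmBE mnm1E eq_sym (negbTE ji) subn0.
ring.
Qed.
End Restriction.

(** A formal leading coefficient: [c] may be zero, so the notion passes to sums and products without
    any nonvanishing condition. *)
Definition top_coef (C : fieldType) (p : {poly C}) d c :=
  (size p <= d.+1)%N /\ p`_d = c.

Lemma top_coefM (C : fieldType) (p q : {poly C}) d e c c' :
  top_coef p d c -> top_coef q e c' -> top_coef (p * q) (d + e) (c * c').
Proof.
move=> [sp <-] [sq <-]; split.
  apply: leq_trans (size_polyMleq p q) _.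
  by rewrite -subn1 leq_subLR add1n -addSn -addnS leq_add.
have lt : (d < (d + e).+1)%N by rewrite ltnS leq_addr.
rewrite coefM (bigD1 (Ordinal lt)) //= addKn big1 ?addr0 // => -[i ile].
rewrite -val_eqE /= => id; have [di|di|/eqP] := ltngtP i d; last by rewrite (negbTE id).
  rewrite [X in _ * X]nth_default ?mulr0 //; apply: leq_trans sq _.
  by rewrite ltn_subRL ltn_add2r.
by rewrite nth_default ?mul0r //; apply: leq_trans sp _.
Qed.

Lemma top_coefX (C : fieldType) (p : {poly C}) d c n :
  top_coef p d c -> top_coef (p ^+ n) (d * n) (c ^+ n).
Proof.
move=> h; elim: n => [|n ih]; first by rewrite muln0; split; rewrite ?size_poly1 ?coefC.
by rewrite !exprS mulnS; exact: top_coefM.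
Qed.

Lemma top_coef_lin (C : fieldType) (v u : C) : top_coef (v%:P + u *: 'X) 1 u.
Proof.
split; last by rewrite coefD coefC coefZ coefX mulr1 add0r.
apply: leq_trans (size_polyD _ _) _; rewrite geq_max.
rewrite (leq_trans (size_polyC_leq1 _)) //=.
by apply: leq_trans (size_scale_leq _ _) _; rewrite size_polyX.
Qed.

Lemma top_coef_linX (C : fieldType) (v u : C) n :
  top_coef ((v%:P + u *: 'X) ^+ n) n (u ^+ n).
Proof. by have := top_coefX n (top_coef_lin v u); rewrite mul1n. Qed.

Lemma top_coefC (C : fieldType) (c : C) : top_coef c%:P 0 c.
Proof. by split; rewrite ?size_polyC_leq1 ?coefC. Qed.

Lemma top_coef_sum (C : fieldType) (I : Type) (r : seq I) (P : pred I)
    (f : I -> {poly C}) d (c : I -> C) :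
  (forall i, P i -> top_coef (f i) d (c i)) ->
  top_coef (\sum_(i <- r | P i) f i) d (\sum_(i <- r | P i) c i).
Proof.
move=> h; apply: (big_ind2 (fun p c => top_coef p d c)) => //.
  by split; rewrite ?size_poly0 ?coef0.
move=> p a q b [sp <-] [sq <-]; split; last by rewrite coefD.
by apply: leq_trans (size_polyD _ _) _; rewrite geq_max sp.
Qed.

Lemma top_coef_prod (C : fieldType) (I : Type) (r : seq I) (P : pred I)
    (f : I -> {poly C}) d (c : I -> C) :
  (forall i, P i -> top_coef (f i) (d i) (c i)) ->
  top_coef (\prod_(i <- r | P i) f i) (\sum_(i <- r | P i) d i)%N
           (\prod_(i <- r | P i) c i).
Proof.
move=> h; elim: r => [|i r ih]; first by rewrite !big_nil; exact: (top_coefC 1).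
by rewrite !big_cons; case: ifP => // Pi; apply: top_coefM ih; exact: h.
Qed.

(** * Restriction to a line in one pair of variables *)

Section Pairs.
Variables (C : fieldType) (n : nat) (lam : 'X_{1..n}).
Implicit Types (F : {mpoly C[n + n]}) (a b : 'I_n -> C).

Lemma meval_pairs F a b :
  F.@[fcat a b] = \sum_(m <- msupp F) F@_m *
    \prod_k (a k ^+ m (lshift n k) * b k ^+ m (rshift n k)).
Proof.
rewrite mevalE; apply: eq_bigr => m _; rewrite big_split_ord big_split /=.
by congr (_ * (_ * _)); apply: eq_bigr => k _; rewrite ?fcat_lshift ?fcat_rshift.
Qed.

Lemma fcatD a b a' b' s :
  fcat (fun k => a k + s * a' k) (fun k => b k + s * b' k) =1
  (fun i => fcat a b i + s * fcat a' b' i).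
Proof. by move=> i; rewrite /fcat; case: split. Qed.

Definition pair_line F k a b u1 u2 :=
  line_poly F (fcat a b) (fcat (upd (fun=> 0) k u1) (upd (fun=> 0) k u2)).

Lemma horner_pair_line F k a b u1 u2 s :
  (pair_line F k a b u1 u2).[s] =
  F.@[fcat (upd a k (a k + s * u1)) (upd b k (b k + s * u2))].
Proof.
rewrite horner_line; apply: meval_eq => i; rewrite -fcatD /fcat.
by case: split => j; rewrite /upd; case: eqP => [->|]; rewrite ?mulr0 ?addr0.
Qed.

Lemma deriv_pair_line F k a b u1 u2 :
  (pair_line F k a b u1 u2)^`().[0] =
  (u1 *: F^`M(lshift n k) + u2 *: F^`M(rshift n k)).@[fcat a b].
Proof.
rewrite deriv_line big_split_ord hornerD mevalD !mevalZ /=.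
congr (_ + _); rewrite (bigD1 k) //= big1 => [|i ik];
  rewrite ?fcat_lshift ?fcat_rshift /upd ?(negbTE ik) ?scale0r //;
  rewrite eqxx addr0 hornerZ horner_line; congr (_ * _);
  by apply: meval_eq => i; rewrite mul0r addr0.
Qed.

(** In each monomial the [k]-th pair contributes [lam k] linear factors in the parameter, whose
    slopes are [u1] and [u2]; the other pairs stay constant. The top coefficient is thus the value
    at the point at infinity of the line, which is its direction. *)
Lemma top_coef_pair_line F k a b u1 u2 : F \is multihomog C lam ->
  top_coef (pair_line F k a b u1 u2) (lam k) F.@[fcat (upd a k u1) (upd b k u2)].
Proof.
move=> /multihomogP hF; rewrite /pair_line /line_poly /mmap meval_pairs.
rewrite big_seq [in X in top_coef _ _ X]big_seq.
apply: top_coef_sum => m mF; rewrite -[lam k]add0n.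
apply: top_coefM; first exact: top_coefC.
rewrite /mmap1 big_split_ord /= -big_split /=.
have -> : lam k = (\sum_j if j == k then lam k else 0)%N.
  by rewrite -big_mkcond big_pred1_eq.
apply: top_coef_prod => j _; rewrite !fcat_lshift !fcat_rshift /upd.
case: eqP => [->|_].
  by rewrite -(hF _ mF); apply: top_coefM; exact: top_coef_linX.
rewrite !scale0r !addr0 -!polyC_exp -polyCM; exact: top_coefC.
Qed.

End Pairs.

(** * Hermitian forms, circular regions and Laguerre's theorem *)

Section Hermitian.
Variable C : numClosedFieldType.
Variables al be de : C.

(** In homogeneous coordinates, the nonnegative set of an indefinite Hermitian form is a closed
    circular region of the sphere, so that disks, half-planes and complements of disks are treated
    alike. *)
Definition herm (x y : C) : C :=
  al * (x * x^*) + be * (x * y^*) + be^* * (y * x^*) + de * (y * y^*).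

Definition in_disk (x y : C) := ((x != 0) || (y != 0)) && (0 <= herm x y).

Hypotheses (al_real : al \is Num.real) (de_real : de \is Num.real).

Lemma herm_real x y : herm x y \is Num.real.
Proof.
rewrite CrealE /herm !(rmorphD, rmorphM) /= !conjCK (CrealP al_real) (CrealP de_real).
by apply/eqP; ring.
Qed.

Lemma hermZ s x y : herm (s * x) (s * y) = (s * s^*) * herm x y.
Proof. by rewrite /herm !rmorphM /=; ring. Qed.

(** The mixed terms are linear in [s] and in its conjugate, so they cancel when the [s] sum to
    zero. *)
Lemma herm_sum (r : seq C) x y u v : \sum_(s <- r) s = 0 ->
  \sum_(s <- r) herm (u + s * x) (v + s * y) =
  herm u v *+ size r + herm x y * \sum_(s <- r) s * s^*.
Proof.
move=> r0; have r0c : \sum_(s <- r) s^* = 0 by rewrite -rmorph_sum r0 rmorph0.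
pose B : C := al * (x * u^*) + be * (x * v^*) + be^* * (y * u^*) + de * (y * v^*).
pose B' : C := al * (u * x^*) + be * (u * y^*) + be^* * (v * x^*) + de * (v * y^*).
have hE s : herm (u + s * x) (v + s * y) =
    herm u v + (B * s + B' * s^*) + herm x y * (s * s^*).
  by rewrite /herm /B /B' !(rmorphD, rmorphM) /=; ring.
rewrite (eq_bigr _ (fun s _ => hE s)); move: (herm u v) (herm x y) => c c'.
rewrite !big_split /= -!mulr_sumr r0 r0c !mulr0 !addr0; congr (_ + _).
by rewrite big_const_seq count_predT iter_addr_0.
Qed.

Lemma in_diskN x y : ((x != 0) || (y != 0)) -> ~ in_disk x y -> herm x y < 0.
Proof.
move=> h /negP; rewrite /in_disk h /=.
by case/real_ge0P: (herm_real x y).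
Qed.

Lemma deriv0_prod_XsubC (r : seq C) : 0 \notin r ->
  (\prod_(z <- r) ('X - z%:P))^`().[0] =
  - (\prod_(z <- r) ('X - z%:P)).[0] * \sum_(z <- r) z^-1.
Proof.
elim: r => [|z r ih]; first by rewrite !big_nil mulr0 -polyC1 derivC hornerC.
rewrite inE negb_or eq_sym => /andP[z0 r0].
rewrite !big_cons derivM derivXsubC mul1r hornerD !hornerM ih // hornerXsubC sub0r.
by field.
Qed.

(** If g'(0) = 0, the logarithmic derivative shows that the inverses of the [d] roots sum to 0. By
    [herm_sum] the values of the form at the pairs (u + x/z, v + y/z), z running over the roots,
    then have a nonnegative sum, while each is a positive multiple of the value at (x + z u, y + z
    v), which is outside the disk. *)
Lemma laguerre_line (g : {poly C}) d x y u v : (0 < d)%N ->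
  (size g <= d.+1)%N -> g`_d != 0 -> g.[0] != 0 ->
  in_disk x y -> in_disk u v ->
  (forall s, g.[s] = 0 -> ~ in_disk (x + s * u) (y + s * v)) ->
  g^`().[0] != 0.
Proof.
move=> d0 sg gd g0 /andP[xy0 hxy] /andP[uv0 huv] root_out; apply/eqP => dg.
have [r gE] := closed_field_poly_normal g.
have lg : lead_coef g != 0.
  by rewrite lead_coef_eq0; apply: contraNneq g0 => ->; rewrite horner0.
have size_r : size r = d.
  apply/eqP; rewrite -eqSS -(size_prod_XsubC r id) -(size_scale _ lg) -gE.
  rewrite eqn_leq sg ltnNge; apply: contra gd => sgd.
  by rewrite nth_default.
have rootP z : z \in r -> g.[z] = 0.
  by move=> zr; apply/rootP; rewrite gE rootZ // root_prod_XsubC.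
have r0 : 0 \notin r by apply: contra g0 => /rootP ->.
have sum0 : \sum_(s <- map (fun z => z^-1) r) s = 0.
  move: dg g0; rewrite big_map gE derivZ !hornerZ deriv0_prod_XsubC //.
  rewrite mulf_eq0 negb_or => dg /andP[_ g0]; apply/eqP; move/eqP: dg.
  by rewrite mulf_eq0 (negbTE lg) mulf_eq0 oppr_eq0 (negbTE g0).
have := herm_sum x y u v sum0; rewrite size_map !big_map => hs.
(* The pair may be (0, 0), which is no point of the sphere and is not governed by the sign outside
   the disk; the equality case of the [leif] records this possibility. *)
have le0 z : z \in r -> herm (u + z^-1 * x) (v + z^-1 * y) <= 0 ?= iff
    ((u + z^-1 * x == 0) && (v + z^-1 * y == 0)).
  move=> zr; have z0 : z != 0 by apply: contraNneq r0 => <-.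
  have -> : u + z^-1 * x = z^-1 * (x + z * u) by field.
  have -> : v + z^-1 * y = z^-1 * (y + z * v) by field.
  rewrite hermZ !mulf_eq0 invr_eq0 (negbTE z0) /=.
  have [/andP[/eqP -> /eqP ->]|out] := boolP ((x + z * u == 0) && _).
    by rewrite /herm conjC0 !mulr0 !addr0 mulr0; exact/leif_refl.
  rewrite negb_and in out; apply/leifP => /=.
  rewrite pmulr_rlt0; first exact: in_diskN out (root_out _ (rootP _ zr)).
  by rewrite -normCK exprn_gt0 // normr_gt0 invr_eq0.
have ge0 : 0 <= \sum_(z <- r) herm (u + z^-1 * x) (v + z^-1 * y).
  rewrite hs addr_ge0 ?mulrn_wge0 ?mulr_ge0 // sumr_ge0 // => z _.
  by rewrite -normCK exprn_ge0.
have eq0 z : z \in r -> (u + z^-1 * x == 0) && (v + z^-1 * y == 0).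
  move=> zr; rewrite -(le0 _ zr).2; apply/negP => /negP neq0.
  have lt : herm (u + z^-1 * x) (v + z^-1 * y) < 0.
    by rewrite lt_neqAle neq0 (le0 _ zr).1.
  have : 0 < 0 :> C; last by rewrite ltxx.
  apply: le_lt_trans ge0 _; rewrite (perm_big _ (perm_to_rem zr)) big_cons.
  rewrite ltr_wnDr // -oppr_ge0 -sumrN big_seq sumr_ge0 // => w /mem_rem wr.
  by rewrite oppr_ge0 (le0 _ wr).1.
move: uv0; rewrite -!normr_gt0.
(* Now (u, v) = - (x, y) / z for every root z. Summing over the roots, whose inverses add up to 0,
   gives d (u, v) = 0, against (u, v) being a point. *)
have uE z : z \in r -> u = - z^-1 * x.
  by move=> /eq0 /andP[/eqP h _]; rewrite mulNr -(addrK (z^-1 * x) u) h sub0r.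
have vE z : z \in r -> v = - z^-1 * y.
  by move=> /eq0 /andP[_ /eqP h]; rewrite mulNr -(addrK (z^-1 * y) v) h sub0r.
have u0 : u *+ size r = 0.
  rewrite -iter_addr_0 -(count_predT r) -big_const_seq.
  rewrite (eq_big_seq (fun z => - x * z^-1)).
    by rewrite -mulr_sumr -(big_map (fun z => z^-1) predT id) sum0 mulr0.
  by move=> z /uE ->; rewrite mulNr mulrC mulNr.
have v0 : v *+ size r = 0.
  rewrite -iter_addr_0 -(count_predT r) -big_const_seq.
  rewrite (eq_big_seq (fun z => - y * z^-1)).
    by rewrite -mulr_sumr -(big_map (fun z => z^-1) predT id) sum0 mulr0.
  by move=> z /vE ->; rewrite mulNr mulrC mulNr.
move/eqP: u0; move/eqP: v0; rewrite !mulrn_eq0 size_r.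
by case: d d0 {sg gd size_r} => // d _ /= /eqP -> /eqP ->; rewrite normr0 ltxx.
Qed.

(** The polar derivative with pole (u : v) is the derivative at 0 of the restriction to the line
    with direction (u, v). Since the pole lies in the disk, the top coefficient of this restriction
    is nonzero, so no root is lost at infinity. *)
Lemma laguerre n (lam : 'X_{1..n}) (F : {mpoly C[n + n]}) k a b u v :
  F \is multihomog C lam -> (0 < lam k)%N ->
  (forall x y, in_disk x y -> F.@[fcat (upd a k x) (upd b k y)] != 0) ->
  in_disk (a k) (b k) -> in_disk u v ->
  (u *: F^`M(lshift n k) + v *: F^`M(rshift n k)).@[fcat a b] != 0.
Proof.
move=> hF l0 nz ab uv; rewrite -deriv_pair_line.
have [sg gd] := top_coef_pair_line k a b u v hF.
apply: (laguerre_line l0 sg _ _ ab uv) => [||s].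
- by rewrite gd nz.
- by rewrite horner_pair_line nz // !mul0r !addr0.
- by rewrite horner_pair_line => /eqP h /nz; rewrite h.
Qed.

End Hermitian.

(** * Transvectants and Grace's theorem *)

Section PairDerivatives.
Variables (C : fieldType) (n : nat) (lam : 'X_{1..n}).
Implicit Types F : {mpoly C[n + n]}.

Lemma multihomog_dx F k : F \is multihomog C lam ->
  F^`M(lshift n k) \is multihomog C (lam - U_(k))%MM.
Proof.
move=> /multihomogP hF; apply/multihomogP => mu.
rewrite mcoeff_msupp mcoeff_mderiv => nz j.
rewrite mnmBE -(hF (mu + U_(lshift n k))%MM); last first.
  by rewrite mcoeff_msupp; apply: contraNneq nz => ->; rewrite mul0rn.
by rewrite !mnmDE !mnm1E eq_lshift eq_lrshift addn0 addnAC addnK.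
Qed.

Lemma multihomog_dy F k : F \is multihomog C lam ->
  F^`M(rshift n k) \is multihomog C (lam - U_(k))%MM.
Proof.
move=> /multihomogP hF; apply/multihomogP => mu.
rewrite mcoeff_msupp mcoeff_mderiv => nz j.
rewrite mnmBE -(hF (mu + U_(rshift n k))%MM); last first.
  by rewrite mcoeff_msupp; apply: contraNneq nz => ->; rewrite mul0rn.
by rewrite !mnmDE !mnm1E eq_rshift eq_rlshift addn0 addnA addnK.
Qed.

(** Up to sign, Cayley's omega operator for the pairs [i] and [j]. *)
Definition transvectant F i j : {mpoly C[n + n]} :=
  F^`M(rshift n i)^`M(lshift n j) - F^`M(lshift n i)^`M(rshift n j).

Lemma transvectantZ c F i j : transvectant (c *: F) i j = c *: transvectant F i j.
Proof. by rewrite /transvectant !mderivZ scalerBr. Qed.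

Lemma transvectant_sum (I : Type) (r : seq I) (P : pred I)
    (f : I -> {mpoly C[n + n]}) i j :
  transvectant (\sum_(t <- r | P t) f t) i j =
  \sum_(t <- r | P t) transvectant (f t) i j.
Proof.
apply: (big_morph (fun F => transvectant F i j)) => [F G|].
  by rewrite /transvectant !mderivD opprD addrACA.
by rewrite /transvectant !mderiv0 subrr.
Qed.

End PairDerivatives.

Section Contraction.
Variable C : numClosedFieldType.
Variables al be de : C.
Hypotheses (al_real : al \is Num.real) (de_real : de \is Num.real).

(** Negating the form gives the closed complementary region; the two regions share exactly the zero
    set of the form. *)
Definition out_disk (x y : C) := in_disk (- al) (- be) (- de) x y.
Local Notation disk := (in_disk al be de).

Lemma out_diskE x y :
  out_disk x y = ((x != 0) || (y != 0)) && (herm al be de x y <= 0).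
Proof.
rewrite /out_disk /in_disk -oppr_ge0; congr (_ && (0 <= _)).
by rewrite /herm rmorphN /=; ring.
Qed.

Variables c1 c2 : C.
Hypotheses (c_in : disk c1 c2) (c_out : out_disk c1 c2).

(* If q = r the form is symmetric in its two arguments, and the root of the form
   with first argument c, being in the disk, can be exchanged with c. *)
Lemma bilinear_contraction p q r s :
  (forall x y z w, disk x y -> out_disk z w ->
     z * (x * p + y * r) + w * (x * q + y * s) != 0) ->
  r - q != 0.
Proof.
move=> nz; apply/eqP => /eqP; rewrite subr_eq0 => /eqP rq; subst r.
pose A := c1 * p + c2 * q; pose D := c1 * q + c2 * s.
have AD : D * A + (- A) * D = 0 by ring.
have [AD0|] := boolP ((D != 0) || (- A != 0)); last first.
  rewrite negb_or !negbK oppr_eq0 => /andP[/eqP D0 /eqP A0].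
  by have := nz _ _ _ _ c_in c_out; rewrite -/A -/D A0 D0 !mulr0 addr0 eqxx.
have [/(nz _ _ _ _ c_in)|out] := boolP (out_disk D (- A)).
  by rewrite -/A -/D AD eqxx.
have ins : disk D (- A).
  rewrite /in_disk AD0 /= ltW // ; move: out; rewrite out_diskE AD0 /=.
  by case/real_le0P: (herm_real be al_real de_real D (- A)).
have := nz _ _ _ _ ins c_out; rewrite (_ : _ + _ = D * A + (- A) * D) ?AD ?eqxx //.
by rewrite /A /D; ring.
Qed.

(** Polarize in pair [i] with a pole in the disk, then in pair [j] with a pole in the complementary
    disk. Laguerre's theorem applies both times, and the result is a nonvanishing bilinear form in
    the two poles; the transvectant is the difference of its two mixed coefficients, so
    [bilinear_contraction] concludes. *)
Lemma transvectant_neq0 n (lam : 'X_{1..n}) (F : {mpoly C[n + n]}) i j a b :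
  i != j -> F \is multihomog C lam -> (0 < lam i)%N -> (0 < lam j)%N ->
  (forall x y z w, disk x y -> out_disk z w ->
     F.@[fcat (upd (upd a j z) i x) (upd (upd b j w) i y)] != 0) ->
  disk (a i) (b i) -> out_disk (a j) (b j) ->
  (transvectant F i j).@[fcat a b] != 0.
Proof.
move=> ij hF li lj nz dab oab; rewrite mevalB.
apply: (bilinear_contraction (p := F^`M(lshift n i)^`M(lshift n j).@[fcat a b])
                             (s := F^`M(rshift n i)^`M(rshift n j).@[fcat a b])).
move=> x y z w dxy ozw.
pose G := x *: F^`M(lshift n i) + y *: F^`M(rshift n i).
rewrite (_ : _ + _ = (z *: G^`M(lshift n j) + w *: G^`M(rshift n j)).@[fcat a b]).
  apply: (@laguerre _ (- al) (- be) (- de) _ _ _ (lam - U_(i))%MM) => //.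
  - by rewrite rpredN.
  - by rewrite rpredN.
  - by apply: rpredD; apply: rpredZ; [exact: multihomog_dx|exact: multihomog_dy].
  - by rewrite mnmBE mnm1E (negbTE ij) subn0.
  move=> z' w' ozw'; apply: (laguerre (be := be) al_real de_real hF) => //.
    by move=> x' y' dxy'; exact: nz.
  by rewrite /upd (negbTE ij).
by rewrite mevalD !mevalZ /G !mderivD !mderivZ !mevalD !mevalZ.
Qed.

End Contraction.

(** * The invariant pairing and Grace's theorem *)

Section Pairing.
Variables (C : numClosedFieldType) (m : nat).
Local Notation N := ((m + m) + (m + m))%N.
Implicit Types (K : {mpoly C[N]}) (mu : 'X_{1..N}) (k : 'I_m).

Definition ix k : 'I_N := lshift (m + m) (lshift m k).
Definition iy k : 'I_N := rshift (m + m) (lshift m k).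
Definition iz k : 'I_N := lshift (m + m) (rshift m k).
Definition iw k : 'I_N := rshift (m + m) (rshift m k).

(* Up to the factor (a + b)!, the value on x^a y^b z^c w^d of the SL2-invariant
   pairing of binary forms. *)
Definition weight1 (a b c d : nat) : C :=
  if (a == d) && (b == c) then (-1) ^+ a * (a`! * b`!)%:R else 0.

Definition weight mu : C :=
  \prod_k weight1 (mu (ix k)) (mu (iy k)) (mu (iz k)) (mu (iw k)).

(* D is a degree bound, which makes the pairing linear on the nose. *)
Definition pairing D K : C := \sum_(mu : 'X_{1..N < D}) K@_mu * weight mu.

Lemma pairingD D K K' : pairing D (K + K') = pairing D K + pairing D K'.
Proof.
by rewrite -big_split; apply: eq_bigr => mu _; rewrite mcoeffD mulrDl.
Qed.

Lemma pairingZ D c K : pairing D (c *: K) = c * pairing D K.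
Proof. by rewrite mulr_sumr; apply: eq_bigr => mu _; rewrite mcoeffZ mulrA. Qed.

Lemma pairing_sum D (I : Type) (r : seq I) (P : pred I) (f : I -> {mpoly C[N]}) :
  pairing D (\sum_(i <- r | P i) f i) = \sum_(i <- r | P i) pairing D (f i).
Proof.
apply: (big_morph (pairing D)); first exact: pairingD.
by rewrite /pairing big1 // => mu _; rewrite mcoeff0 mul0r.
Qed.

Lemma pairingX D mu : (mdeg mu < D)%N -> pairing D 'X_[mu] = weight mu.
Proof.
move=> h; rewrite /pairing (bigD1 (BMultinom h)) //= mcoeffX eqxx mul1r.
rewrite big1 ?addr0 // => nu; rewrite -val_eqE /= eq_sym mcoeffX.
by move/negbTE => ->; rewrite mul0r.
Qed.

(** The factor produced by differentiating a monomial is absorbed by the factorials of the weight.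
    Predecessors truncated at 0 only occur with coefficient 0. *)
Lemma weight1_dydz a b c d :
  (b * c)%:R * weight1 a b.-1 c.-1 d = b%:R * weight1 a b c d.
Proof.
rewrite /weight1; case: b => [|b]; first by rewrite !mul0r.
case: c => [|c]; first by rewrite andbF muln0 mul0r mulr0.
rewrite /= eqSS; case: eqP => //= ad; last by rewrite !mulr0.
case: eqP => [->|]; last by rewrite !mulr0.
by rewrite factS !natrM; ring.
Qed.

Lemma weight1_dxdw a b c d :
  (a * d)%:R * weight1 a.-1 b c d.-1 = - (a%:R * weight1 a b c d).
Proof.
rewrite /weight1; case: a => [|a]; first by rewrite !mul0r oppr0.
case: d => [|d]; first by rewrite muln0 mul0r mulr0 oppr0.
rewrite /= eqSS; case: eqP => [->|] /=; last by rewrite !mulr0 oppr0.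
case: ifP => _; last by rewrite !mulr0 oppr0.
by rewrite factS exprS !natrM; ring.
Qed.

Lemma weight_bigD1 k mu (nu : 'X_{1..N}) :
  (forall j, j != k -> [/\ nu (ix j) = mu (ix j), nu (iy j) = mu (iy j),
     nu (iz j) = mu (iz j) & nu (iw j) = mu (iw j)]) ->
  weight nu = weight1 (nu (ix k)) (nu (iy k)) (nu (iz k)) (nu (iw k)) *
    \prod_(j | j != k) weight1 (mu (ix j)) (mu (iy j)) (mu (iz j)) (mu (iw j)).
Proof.
move=> h; rewrite /weight (bigD1 k) //=; congr (_ * _).
by apply: eq_bigr => j /h[-> -> -> ->].
Qed.

Lemma pairing_transvectantX D k mu : (mdeg mu < D)%N ->
  pairing D (transvectant 'X_[mu] (lshift m k) (rshift m k)) =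
  (mu (ix k) + mu (iy k))%:R * weight mu.
Proof.
move=> hD; rewrite /transvectant -/(ix k) -/(iy k) -/(iz k) -/(iw k).
have degB (nu nu' : 'X_{1..N}) : (mdeg nu < D)%N -> (mdeg (nu - nu')%MM < D)%N.
  by apply: leq_ltn_trans; exact: mdegB.
rewrite !mderivX !mderivZ !mderivX -scaleN1r !pairingD !pairingZ.
rewrite !pairingX ?degB //.
have E := (@mnm1E, @eq_lshift, @eq_rshift, @eq_lrshift, @eq_rlshift).
rewrite !(@weight_bigD1 k mu) //; first last.
- by move=> j jk; rewrite !mnmBE !E eq_sym (negbTE jk) !subn0.
- by move=> j jk; rewrite !mnmBE !E eq_sym (negbTE jk) !subn0.
rewrite !mnmBE !E !eqxx !subn0 !subn1 !mulN1r !mulrA -!natrM.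
by rewrite weight1_dydz weight1_dxdw natrD; ring.
Qed.

Lemma mdeg_pairs (lam : 'X_{1..m + m}) K mu : K \is multihomog C lam ->
  mu \in msupp K -> mdeg mu = mdeg lam.
Proof.
move=> /multihomogP hK /hK h; rewrite !mdegE big_split_ord /= -big_split /=.
by apply: eq_bigr.
Qed.

(** The transvectant lowers both degrees of the [k]-th pairs by one and only multiplies the pairing
    by the degree: this is the recursion that evaluates the pairing down to a constant. *)
Lemma pairing_transvectant D (lam : 'X_{1..m}) k K :
  K \is multihomog C (mcat lam lam) -> (mdeg (mcat lam lam) < D)%N ->
  pairing D (transvectant K (lshift m k) (rshift m k)) = (lam k)%:R * pairing D K.
Proof.
move=> hK hD; rewrite [K]mpolyE transvectant_sum !pairing_sum.
rewrite mulr_sumr; apply: eq_big_seq => mu muK.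
rewrite transvectantZ !pairingZ mulrCA; congr (_ * _).
have muD : (mdeg mu < D)%N by rewrite (mdeg_pairs hK muK).
rewrite [LHS]pairing_transvectantX // pairingX //.
by have /multihomogP -> := hK; rewrite // mnmE fcat_lshift.
Qed.

Lemma mcatB1 (lam : 'X_{1..m}) k :
  (mcat lam lam - U_(lshift m k) - U_(rshift m k))%MM =
  mcat (lam - U_(k))%MM (lam - U_(k))%MM.
Proof.
apply/mnmP => i; case: (split_ordP i) => j ->; rewrite !(mnmBE, mnmE);
  by rewrite ?(fcat_lshift, fcat_rshift) !(eq_lshift, eq_rshift, eq_lrshift,
     eq_rlshift) ?subn0 mnmBE mnm1E.
Qed.

Section Grace.
Variables al be de : C.
Hypotheses (al_real : al \is Num.real) (de_real : de \is Num.real).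
Variables c1 c2 : C.
Hypotheses (c_in : in_disk al be de c1 c2) (c_out : out_disk al be de c1 c2).

(** Induction on the total degree: as long as some [lam k] is positive, the transvectant in the two
    [k]-th pairs keeps the zero-free region and changes the pairing by a nonzero factor. *)
Lemma grace D (lam : 'X_{1..m}) K :
  K \is multihomog C (mcat lam lam) -> (mdeg (mcat lam lam) < D)%N ->
  (forall a b : 'I_(m + m) -> C,
     (forall k, in_disk al be de (a (lshift m k)) (b (lshift m k))) ->
     (forall k, out_disk al be de (a (rshift m k)) (b (rshift m k))) ->
     K.@[fcat a b] != 0) ->
  pairing D K != 0.
Proof.
move: {2}(mdeg lam) (erefl (mdeg lam)) => d; elim: d lam K => [|d ih] lam K.
  move/eqP; rewrite mdeg_eq0 => /eqP -> hK hD nz.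
  have KE : K = K@_0 *: 'X_[0].
    apply/mpolyP => mu; rewrite mcoeffZ mcoeffX; have [<-|mu0] := eqVneq.
      by rewrite mulr1.
    rewrite mulr0; apply/eqP; rewrite mcoeff_eq0; apply: contra mu0 => /(mdeg_pairs hK).
    rewrite (_ : mcat _ _ = 0%MM) ?mdeg0; last first.
      by apply/mnmP => i; rewrite mnmE mnm0E /fcat; case: split => j; rewrite mnm0E.
    by move/eqP; rewrite mdeg_eq0 eq_sym.
  (* In degree 0 the polynomial is a constant, and the common boundary point of the two disks is an
     admissible argument in every pair at once, so the constant is nonzero. *)
  have := nz (fun=> c1) (fun=> c2) (fun=> c_in) (fun=> c_out).
  have w0 : weight 0%MM = 1.
    by rewrite /weight big1 // => k _; rewrite /weight1 !mnm0E /= mulr1.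
  by rewrite KE mevalZ pairingZ pairingX ?mdeg0 ?(leq_trans _ hD) // w0 mpolyX0 meval1.
move=> dE hK hD nz; have [k lk] : exists k, (0 < lam k)%N.
  apply/existsP; apply: contra_eqT dE => /existsPn h; rewrite mdegE big1 // => i _.
  by apply/eqP; rewrite -leqn0 leqNgt h.
have hD' (mu : 'X_{1..m + m}) : (mdeg mu <= mdeg (mcat lam lam) -> mdeg mu < D)%N.
  by move=> le; exact: leq_ltn_trans hD.
have l0 : (lam k)%:R != 0 :> C by rewrite pnatr_eq0 -lt0n.
have lr : lshift m k != rshift m k by rewrite eq_lrshift.
suff : pairing D (transvectant K (lshift m k) (rshift m k)) != 0.
  by rewrite (pairing_transvectant k hK hD) mulf_eq0 negb_or => /andP[].
have K'hom : transvectant K (lshift m k) (rshift m k) \is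
    multihomog C (mcat (lam - U_(k))%MM (lam - U_(k))%MM).
  by rewrite -mcatB1; apply: rpredB; [apply/multihomog_dx/multihomog_dy|
    apply/multihomog_dy/multihomog_dx].
apply: (ih (lam - U_(k))%MM) => //.
- rewrite !mdegE in dE *; rewrite (bigD1 k) //= mnmBE mnm1E eqxx subn1.
  move: dE; rewrite (bigD1 k) //= => dE.
  rewrite (eq_bigr lam) => [|j jk]; last first.
    by rewrite mnmBE mnm1E eq_sym (negbTE jk) subn0.
  by case: (lam k) lk dE => // p _ [].
- by apply: hD'; rewrite -mcatB1; apply: leq_trans (mdegB _ _) (mdegB _ _).
move=> a b hab hout; apply: (transvectant_neq0 al_real de_real c_in c_out lr hK).
- by rewrite mnmE fcat_lshift.
- by rewrite mnmE fcat_rshift.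
- move=> x y z w hxy hzw; apply: nz => j; rewrite /upd.
    by rewrite eq_lshift; case: eqP => // _; rewrite eq_lrshift.
  by rewrite eq_rlshift eq_rshift; case: eqP.
- exact: hab.
- exact: hout.
Qed.
End Grace.
End Pairing.

(** * Expansion in monomials and values of the symbol *)

Section Expansion.
Variables (K : comNzRingType) (m : nat) (lam : 'X_{1..m}).
Implicit Types (p : mhpoly K lam) (z w x y : 'I_m -> K) (mu : 'X_{1..m}).

Lemma mhpoly_val_sum (I : Type) (r : seq I) (P : pred I) (f : I -> mhpoly K lam) :
  mhpoly_val (\sum_(i <- r | P i) f i) = \sum_(i <- r | P i) (f i : {mpoly K[m + m]}).
Proof. exact: (raddf_sum (val : mhpoly K lam -> {mpoly K[m + m]})). Qed.

Lemma mhpoly_valZ c p : mhpoly_val (c *: p) = c *: (p : {mpoly K[m + m]}).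
Proof. exact: GRing.valZ. Qed.

Lemma xymonX mu : (mu <= lam)%MM ->
  xymon K lam mu = 'X_[mcat mu (lam - mu)%MM] :> {mpoly K[m + m]}.
Proof.
move=> /mnm_lepP le; rewrite /xymon insubdK //.
by apply: multihomogX => k; rewrite !mnmE fcat_lshift fcat_rshift mnmBE subnKC.
Qed.

Definition mhcoef p mu : K := (p : {mpoly K[m + m]})@_(mcat mu (lam - mu)%MM).

Lemma mhpoly_expand p :
  p = \sum_(mu : 'X_{1..m < (mdeg lam).+1} | (mu <= lam)%MM)
        mhcoef p mu *: xymon K lam mu.
Proof.
apply: val_inj => /=; rewrite mhpoly_val_sum; apply/mpolyP => nu.
rewrite raddf_sum /=.
under eq_bigr => mu le do rewrite xymonX // mcoeffZ mcoeffX.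
have [nup|nup] := boolP (nu \in msupp (p : {mpoly _[_]})); last first.
  rewrite (memN_msupp_eq0 nup) big1 // => mu le.
  case: eqP => [e|]; last by rewrite mulr0.
  by rewrite /mhcoef e (memN_msupp_eq0 nup) mul0r.
pose mu0 : 'X_{1..m} := [multinom nu (lshift m k) | k < m].
have hnu k : (nu (lshift m k) + nu (rshift m k) = lam k)%N.
  by case: p nup => p /= /multihomogP h /h.
have mu0lam : (mu0 <= lam)%MM.
  by apply/mnm_lepP => k; rewrite mnmE -hnu leq_addr.
have mu0D : (mdeg mu0 < (mdeg lam).+1)%N.
  by rewrite ltnS !mdegE leq_sum // => k _; move/mnm_lepP: mu0lam; apply.
have cat0 : mcat mu0 (lam - mu0)%MM = nu.
  apply/mnmP => i; rewrite mnmE; case: (split_ordP i) => k ->.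
    by rewrite fcat_lshift mnmE.
  by rewrite fcat_rshift mnmBE mnmE -hnu addKn.
rewrite (bigD1 (BMultinom mu0D)) //= cat0 eqxx mulr1 big1 ?addr0 /mhcoef ?cat0 //.
move=> mu /andP[le]; rewrite -val_eqE /= => ne.
case: eqP => [e|]; last by rewrite mulr0.
case/eqP: ne; apply/mnmP => k; rewrite mnmE -e mnmE fcat_lshift //.
Qed.

(** The coefficient of x^mu y^(lam - mu) in prod_k (z_k y_k - x_k w_k)^lam_k. The polynomial
    [linear_power] built from it is the f_a of the overview, kept in expanded form so that a linear
    operator applies termwise. *)
Definition power_coef z w mu : K :=
  \prod_k ('C(lam k, mu k)%:R * (z k ^+ (lam k - mu k) * (- w k) ^+ mu k)).

Definition linear_power z w : mhpoly K lam :=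
  \sum_(mu : 'X_{1..m < (mdeg lam).+1} | (mu <= lam)%MM)
    power_coef z w mu *: xymon K lam mu.

Lemma meval_xymon mu x y : (mu <= lam)%MM ->
  (mhpoly_val (xymon K lam mu)).@[fcat x y] =
  \prod_k (x k ^+ mu k * y k ^+ (lam k - mu k)).
Proof.
move=> le; rewrite xymonX // mevalX big_split_ord big_split /=.
by congr (_ * _); apply: eq_bigr => k _;
  rewrite !(fcat_lshift, fcat_rshift) mnmE !(fcat_lshift, fcat_rshift) ?mnmBE.
Qed.

Lemma meval_mhsum (c : 'X_{1..m} -> K) v :
  (mhpoly_val (\sum_(mu : 'X_{1..m < (mdeg lam).+1} | (mu <= lam)%MM)
     c mu *: xymon K lam mu)).@[v] =
  \sum_(mu : 'X_{1..m < (mdeg lam).+1} | (mu <= lam)%MM)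
     c mu * (mhpoly_val (xymon K lam mu)).@[v].
Proof.
by rewrite mhpoly_val_sum raddf_sum /=; apply: eq_bigr => mu _; rewrite mevalZ.
Qed.

Lemma meval_mhlin (a b : K) p q v :
  (mhpoly_val (a *: p + b *: q)).@[v] =
  a * (mhpoly_val p).@[v] + b * (mhpoly_val q).@[v].
Proof. by rewrite -2!mevalZ -mevalD. Qed.

(** Distributivity of a product over sums, with choice functions identified with multi-indices below
    [lam]. *)
Lemma sum_le_lam (F : 'I_m -> nat -> K) :
  \sum_(mu : 'X_{1..m < (mdeg lam).+1} | (mu <= lam)%MM) \prod_k F k (mu k) =
  \prod_k \sum_(j < (lam k).+1) F k j.
Proof.
pose d := (mdeg lam).+1.
have lamd k : (lam k <= mdeg lam)%N by rewrite mdegE (bigD1 k) //= leq_addr.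
(* The ranges depend on [k]; they are widened to one common bound, with 0 for the extra terms, so
   that distributivity over a fixed index type applies. *)
transitivity (\prod_k \sum_(j < d) if (j <= lam k)%N then F k j else 0); last first.
  apply: eq_bigr => k _; rewrite -big_mkcond /=.
  by rewrite (big_ord_widen d (F k)) // ltnS lamd.
rewrite bigA_distr_bigA /=.
rewrite (bigID (fun f : {ffun 'I_m -> 'I_d} => [forall k, (f k <= lam k)%N])) /=.
rewrite [X in _ = _ + X]big1 ?addr0; last first.
  move=> f /forallPn [k kn]; rewrite (bigD1 k) //= (negbTE kn) mul0r //.
(* The default [bm0] does not occur for functions bounded by [lam], whose total degree is below
   [d]. *)
pose phi (f : {ffun 'I_m -> 'I_d}) : 'X_{1..m < d} :=
  insubd bm0 [multinom (f k : nat) | k < m].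
pose psi (mu : 'X_{1..m < d}) : {ffun 'I_m -> 'I_d} := [ffun k => inord (mu k)].
have phiE (f : {ffun 'I_m -> 'I_d}) : [forall k, (f k <= lam k)%N] ->
    (phi f : 'X_{1..m}) = [multinom (f k : nat) | k < m].
  move=> /forallP le; rewrite /phi insubdK // -topredE /= ltnS !mdegE leq_sum // => k _.
  by rewrite mnmE.
rewrite (reindex_onto phi psi) /=; last first.
  move=> mu /mnm_lepP le; apply: val_inj => /=; rewrite phiE; last first.
    by apply/forallP => k; rewrite ffunE inordK // ltnS (leq_trans (le k)).
  apply/mnmP => k; rewrite mnmE ffunE inordK // ltnS (leq_trans (le k)) //.
apply: eq_big => [f|f].
  apply/andP/forallP => [[/mnm_lepP le /eqP e] k|le].
    rewrite -e ffunE inordK //; apply: leq_trans (le k) _; exact: lamd.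
  have h : [forall k, (f k <= lam k)%N] by apply/forallP.
  split; first by apply/mnm_lepP => k; rewrite phiE // mnmE.
  by apply/eqP/ffunP => k; rewrite ffunE phiE // mnmE inord_val.
move=> /andP[/mnm_lepP le /eqP e]; apply: eq_bigr => k _.
have h : [forall k, (f k <= lam k)%N].
  apply/forallP => j; rewrite -e ffunE inordK //.
  by apply: leq_trans (le j) _; exact: lamd.
by rewrite phiE // mnmE (forallP h).
Qed.

Lemma linear_powerE z w x y :
  (mhpoly_val (linear_power z w)).@[fcat x y] =
  \prod_k (z k * y k - x k * w k) ^+ lam k.
Proof.
pose F k j := 'C(lam k, j)%:R * (z k ^+ (lam k - j) * (- w k) ^+ j) *
  (x k ^+ j * y k ^+ (lam k - j)).
rewrite meval_mhsum; transitivity (\prod_k \sum_(j < (lam k).+1) F k j).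
  rewrite -sum_le_lam; apply: eq_bigr => mu le; rewrite big_split /=.
  by congr (_ * _); rewrite meval_xymon.
apply: eq_bigr => k _; rewrite -mulrN /F; move: (- w k) => w'.
by rewrite exprDn; apply: eq_bigr => j _; rewrite !exprMn -mulr_natl; ring.
Qed.

End Expansion.

Section SymbolEvaluation.
Variables (K : comNzRingType) (m l : nat) (lam : 'X_{1..m}) (al : 'X_{1..l}).
Variable T : {linear mhpoly K lam -> mhpoly K al}.

Lemma meval_image_sum (c : 'X_{1..m} -> K) v :
  (mhpoly_val (T (\sum_(mu : 'X_{1..m < (mdeg lam).+1} | (mu <= lam)%MM)
     c mu *: xymon K lam mu))).@[v] =
  \sum_(mu : 'X_{1..m < (mdeg lam).+1} | (mu <= lam)%MM)
     c mu * (mhpoly_val (T (xymon K lam mu))).@[v].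
Proof.
rewrite raddf_sum mhpoly_val_sum raddf_sum /=; apply: eq_bigr => mu _.
by rewrite linearZ mhpoly_valZ mevalZ.
Qed.

(** By linearity, specializing the pairs (z, w) in the symbol amounts to applying [T] to the
    corresponding product of powers of linear forms. *)
Lemma meval_Symb (a b : 'I_(m + l) -> K) :
  (mhpoly_val (Symb T)).@[fcat a b] =
  (mhpoly_val
    (T (linear_power lam (fun k => a (lshift l k)) (fun k => b (lshift l k))))).@[
    fcat (fun j => a (rshift m j)) (fun j => b (rshift m j))].
Proof.
rewrite meval_image_sum /= /symb_poly raddf_sum; apply: eq_bigr => mu _ /=.
rewrite mevalZ mevalM comp_mpoly_meval mulrA; congr (_ * _).
  rewrite natr_prod rmorph_prod -big_split; apply: eq_bigr => k _ /=.
  rewrite mevalM !rmorphXn /= /zvar /wvar mevalN !mevalXU.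
  by rewrite fcat_lshift fcat_rshift.
apply: meval_eq => i; rewrite tnth_mktuple; case: (split_ordP i) => j ->;
  by rewrite !(fcat_lshift, fcat_rshift) mevalXU !(fcat_lshift, fcat_rshift).
Qed.

End SymbolEvaluation.

(** * Grace's theorem for a polynomial against a symbol *)

Section GracePairing.
Variables (C : numClosedFieldType) (m : nat) (lam : 'X_{1..m}).
Variables (p : mhpoly C lam) (t : 'X_{1..m} -> C).

Definition exp4 (mu nu : 'X_{1..m}) : 'X_{1..(m + m) + (m + m)} :=
  mcat (mcat mu (lam - nu)%MM) (mcat (lam - mu)%MM nu).

(** The product of p(x, y) with the polynomial in (z, w) that has the shape of a symbol with images
    [t nu]. Evaluating [power_coef] at ones isolates its signed binomial coefficient. *)
Definition dual_poly : {mpoly C[(m + m) + (m + m)]} :=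
  \sum_(mu : 'X_{1..m < (mdeg lam).+1} | (mu <= lam)%MM)
  \sum_(nu : 'X_{1..m < (mdeg lam).+1} | (nu <= lam)%MM)
    (mhcoef p mu * (power_coef lam (fun=> 1) (fun=> 1) nu * t nu)) *: 'X_[exp4 mu nu].

Lemma dual_poly_multihomog : dual_poly \is multihomog C (mcat lam lam).
Proof.
apply: rpred_sum => mu /mnm_lepP le; apply: rpred_sum => nu /mnm_lepP le'.
apply: rpredZ; apply: multihomogX => k; rewrite !mnmE !fcat_lshift !fcat_rshift !mnmE.
case: (split_ordP k) => j ->; rewrite !(fcat_lshift, fcat_rshift) mnmBE.
  by rewrite subnKC.
by rewrite subnK.
Qed.

Lemma meval_dual_poly a b : dual_poly.@[fcat a b] =
  (mhpoly_val p).@[fcat (fun k => a (lshift m k)) (fun k => b (lshift m k))] *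
  \sum_(nu : 'X_{1..m < (mdeg lam).+1} | (nu <= lam)%MM)
    power_coef lam (fun k => a (rshift m k)) (fun k => b (rshift m k)) nu * t nu.
Proof.
rewrite [in RHS](mhpoly_expand p) meval_mhsum big_distrlr raddf_sum /=.
apply: eq_bigr => mu le; rewrite raddf_sum; apply: eq_bigr => nu _ /=.
rewrite mevalZ mevalX meval_xymon //.
have E : \prod_i fcat a b i ^+ exp4 mu nu i * power_coef lam (fun=> 1) (fun=> 1) nu =
    \prod_k (a (lshift m k) ^+ mu k * b (lshift m k) ^+ (lam k - mu k)) *
    power_coef lam (fun k => a (rshift m k)) (fun k => b (rshift m k)) nu.
  rewrite /power_coef !big_split_ord /= -!big_split /=; apply: eq_bigr => k _.
  rewrite !(fcat_lshift, fcat_rshift) !mnmE !(fcat_lshift, fcat_rshift) !mnmE.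
  rewrite !(fcat_lshift, fcat_rshift) -[- b _]mulN1r exprMn expr1n.
  by rewrite !mnmBE; move: ((-1) ^+ nu k) => e; ring.
move: E; set P := \prod_i _; set pc := power_coef _ _ _ _; set P' := \prod_k _.
set pc' := power_coef _ _ _ _ => E.
by transitivity (mhcoef p mu * t nu * (P * pc)); [|rewrite E]; ring.
Qed.

(** The weight kills all terms with [nu] different from [mu]; on the others its sign and factorials
    combine with the signed binomials into the product of the [(lam k)]!. *)
Lemma pairing_dual_poly D : (mdeg (mcat lam lam) < D)%N ->
  pairing D dual_poly = (\prod_k (lam k)`!)%:R *
  \sum_(mu : 'X_{1..m < (mdeg lam).+1} | (mu <= lam)%MM) mhcoef p mu * t mu.
Proof.
move=> hD; rewrite /dual_poly pairing_sum mulr_sumr; apply: eq_bigr => mu le.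
have degE nu : (nu <= lam)%MM -> (mdeg (exp4 mu nu) < D)%N.
  move=> le'; apply: leq_ltn_trans hD; rewrite mdegE [mdeg (mcat _ _)]mdegE.
  rewrite !big_split_ord /= -!big_split /=.
  apply: leq_sum => k _; rewrite !mnmE !(fcat_lshift, fcat_rshift) !mnmE.
  rewrite !(fcat_lshift, fcat_rshift) !mnmE.
  move/mnm_lepP: le => /(_ k) h; move/mnm_lepP: le' => /(_ k) h'.
  by rewrite addnACA subnKC // subnK.
rewrite pairing_sum (bigD1 mu) //= big1 ?addr0; last first.
  move=> nu /andP[le' ne]; rewrite pairingZ pairingX ?degE //.
  have [k kne] : exists k, mu k != nu k.
    apply/existsP; apply: contraNT ne => /existsPn h; rewrite -val_eqE /=.
    by apply/eqP/mnmP => k; have /negPn/eqP := h k.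
  rewrite /weight (bigD1 k) //= /weight1 /exp4.
  rewrite !mnmE !(fcat_lshift, fcat_rshift) !mnmE !(fcat_lshift, fcat_rshift).
  by rewrite (negbTE kne) /= mul0r mulr0.
rewrite pairingZ pairingX ?degE //.
have wE : power_coef lam (fun=> 1) (fun=> 1) mu * weight C (exp4 mu mu) =
    (\prod_k (lam k)`!)%:R.
  rewrite /power_coef /weight -big_split natr_prod /=; apply: eq_bigr => k _.
  rewrite /exp4 !mnmE !(fcat_lshift, fcat_rshift) !mnmE !(fcat_lshift, fcat_rshift).
  rewrite /weight1 !mnmE !eqxx /= expr1n.
  move/mnm_lepP: le => /(_ k) h; rewrite -(bin_fact h) natrM mul1r.
  have s2 : (-1) ^+ mu k * (-1) ^+ mu k = 1 :> C.
    by rewrite -exprMn mulrNN mulr1 expr1n.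
  rewrite -[RHS]mul1r -[X in _ = X * _]s2 !natrM.
  by move: ((-1) ^+ mu k) => e; ring.
rewrite -wE; ring.
Qed.

(** With [t mu] the value at a fixed point of the image of the [mu]-th monomial, the last hypothesis
    concerns the symbol and the conclusion is the nonvanishing of the image of [p] at that point. *)
Lemma grace_mhpoly al be de c1 c2 : al \is Num.real -> de \is Num.real ->
  in_disk al be de c1 c2 -> out_disk al be de c1 c2 ->
  (forall x y : 'I_m -> C, (forall k, in_disk al be de (x k) (y k)) ->
     (mhpoly_val p).@[fcat x y] != 0) ->
  (forall z w : 'I_m -> C, (forall k, out_disk al be de (z k) (w k)) ->
     \sum_(nu : 'X_{1..m < (mdeg lam).+1} | (nu <= lam)%MM)
        power_coef lam z w nu * t nu != 0) ->
  \sum_(mu : 'X_{1..m < (mdeg lam).+1} | (mu <= lam)%MM) mhcoef p mu * t mu != 0.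
Proof.
move=> alR deR cin cout hp ht.
have := grace alR deR cin cout dual_poly_multihomog (ltnSn _).
rewrite pairing_dual_poly // mulf_eq0 negb_or => h.
suff nz a b : (forall k, in_disk al be de (a (lshift m k)) (b (lshift m k))) ->
    (forall k, out_disk al be de (a (rshift m k)) (b (rshift m k))) ->
    dual_poly.@[fcat a b] != 0 by have /andP[] := h nz.
by move=> hin hout; rewrite meval_dual_poly mulf_neq0 // ?hp ?ht.
Qed.
End GracePairing.

Local Open Scope complex_scope.
Local Open Scope classical_set_scope.

(** * Compactness *)

Section ComplexParts.
Variable R : realType.
Local Notation C := R[i].
Local Notation Re := complex.Re.
Local Notation Im := complex.Im.
Implicit Types x y a b : C.

Lemma ReD x y : Re (x + y) = Re x + Re y. Proof. by case: x y => [? ?] [? ?]. Qed.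
Lemma ImD x y : Im (x + y) = Im x + Im y. Proof. by case: x y => [? ?] [? ?]. Qed.
Lemma ReM x y : Re (x * y) = Re x * Re y - Im x * Im y.
Proof. by case: x y => [? ?] [? ?]. Qed.
Lemma ImM x y : Im (x * y) = Re x * Im y + Im x * Re y.
Proof. by case: x y => [? ?] [? ?]. Qed.

Definition sqnorm x : R := Re x ^+ 2 + Im x ^+ 2.

Lemma sqnorm_ge0 x : 0 <= sqnorm x.
Proof. by rewrite addr_ge0 ?sqr_ge0. Qed.

Lemma sqnorm_eq0 x : (sqnorm x == 0) = (x == 0).
Proof.
by case: x => a b; rewrite paddr_eq0 ?sqr_ge0 // !sqrf_eq0 eq_complex.
Qed.

Lemma sqnormM x y : sqnorm (x * y) = sqnorm x * sqnorm y.
Proof. by rewrite /sqnorm ReM ImM; ring. Qed.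

(* The imaginary part of a * b^*: its sign tells the half-plane of (a : b). *)
Definition cross a b : R := Im a * Re b - Re a * Im b.

Lemma crossZ s a b : cross (s * a) (s * b) = sqnorm s * cross a b.
Proof. by rewrite /cross /sqnorm !ReM !ImM; ring. Qed.

(** For [e] > 0 these coefficients describe a closed disk inside the open upper half-plane, possibly
    empty, whose complement contains the closed lower half-plane. *)
Lemma herm_cross (e : R) a b :
  herm ((- e)%:C) (0 +i* (- 2^-1)) ((- e)%:C) a b =
  (cross a b - e * (sqnorm a + sqnorm b))%:C.
Proof.
have conjE (c : C) : Num.conj c = Re c -i* Im c by case: c.
rewrite /herm !conjE /cross /sqnorm; case: a b => [a1 a2] [b1 b2] /=.
apply/eqP; rewrite eq_complex /=; apply/andP; split; apply/eqP; lra.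
Qed.

End ComplexParts.

Section Continuity.
Variable R : realType.
Local Notation C := R[i].
Local Notation Re := complex.Re.
Local Notation Im := complex.Im.
Variable X : topologicalType.
Implicit Types f g : X -> C.

Definition ccontinuous f :=
  continuous (fun x => Re (f x) : R) /\ continuous (fun x => Im (f x) : R).

Lemma ccontinuous_cst c : ccontinuous (fun=> c).
Proof. by split; exact: cst_continuous. Qed.

Lemma ccontinuousD f g : ccontinuous f -> ccontinuous g ->
  ccontinuous (fun x => f x + g x).
Proof.
move=> [f1 f2] [g1 g2]; split => x.
  by under eq_fun do rewrite ReD; apply: cvgD; [exact: f1|exact: g1].
by under eq_fun do rewrite ImD; apply: cvgD; [exact: f2|exact: g2].
Qed.

Lemma ccontinuousM f g : ccontinuous f -> ccontinuous g ->
  ccontinuous (fun x => f x * g x).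
Proof.
move=> [f1 f2] [g1 g2]; split => x.
  under eq_fun do rewrite ReM; apply: cvgB; apply: cvgM.
  - exact: f1. - exact: g1. - exact: f2. - exact: g2.
under eq_fun do rewrite ImM; apply: cvgD; apply: cvgM.
- exact: f1. - exact: g2. - exact: f2. - exact: g1.
Qed.

Lemma ccontinuousN f : ccontinuous f -> ccontinuous (fun x => - f x).
Proof.
move=> hf; under eq_fun do rewrite -mulN1r; apply: ccontinuousM hf.
exact: ccontinuous_cst.
Qed.

Lemma ccontinuousX f n : ccontinuous f -> ccontinuous (fun x => f x ^+ n).
Proof.
move=> hf; elim: n => [|n ih].
  by under eq_fun do rewrite expr0; exact: ccontinuous_cst.
by under eq_fun do rewrite exprS; exact: ccontinuousM.
Qed.

Lemma ccontinuous_sum (I : Type) (r : seq I) (P : pred I) (F : I -> X -> C) :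
  (forall i, ccontinuous (F i)) -> ccontinuous (fun x => \sum_(i <- r | P i) F i x).
Proof.
move=> h; elim: r => [|i r ih].
  by under eq_fun do rewrite big_nil; exact: ccontinuous_cst.
under eq_fun do rewrite big_cons; case: (P i) => //.
exact: ccontinuousD.
Qed.

Lemma ccontinuous_prod (I : Type) (r : seq I) (P : pred I) (F : I -> X -> C) :
  (forall i, ccontinuous (F i)) -> ccontinuous (fun x => \prod_(i <- r | P i) F i x).
Proof.
move=> h; elim: r => [|i r ih].
  by under eq_fun do rewrite big_nil; exact: ccontinuous_cst.
under eq_fun do rewrite big_cons; case: (P i) => //.
exact: ccontinuousM.
Qed.

Lemma ccontinuous_meval n (p : {mpoly C[n]}) (v : 'I_n -> X -> C) :
  (forall i, ccontinuous (v i)) -> ccontinuous (fun x => p.@[fun i => v i x]).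
Proof.
move=> h; under eq_fun do rewrite mevalE; apply: ccontinuous_sum => m.
apply: ccontinuousM; first exact: ccontinuous_cst.
by apply: ccontinuous_prod => i; exact: ccontinuousX.
Qed.

Lemma ccontinuous_power_coef m (lam mu : 'X_{1..m}) (z w : 'I_m -> X -> C) :
  (forall k, ccontinuous (z k)) -> (forall k, ccontinuous (w k)) ->
  ccontinuous (fun x => power_coef lam (fun k => z k x) (fun k => w k x) mu).
Proof.
move=> hz hw; apply: ccontinuous_prod => k.
apply: ccontinuousM; first exact: ccontinuous_cst.
by apply: ccontinuousM; apply: ccontinuousX => //; exact: ccontinuousN.
Qed.

Lemma continuous_sqnorm f : ccontinuous f -> continuous (fun x => sqnorm (f x) : R).
Proof.
move=> [f1 f2] x; apply: cvgD; apply: cvgM; [exact: f1|exact: f1|exact: f2|exact: f2].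
Qed.

Lemma continuous_sqnormD f g : ccontinuous f -> ccontinuous g ->
  continuous (fun x => sqnorm (f x) + sqnorm (g x) : R).
Proof.
by move=> hf hg x; apply: cvgD; [exact: continuous_sqnorm|exact: continuous_sqnorm].
Qed.

Lemma continuous_cross f g : ccontinuous f -> ccontinuous g ->
  continuous (fun x => cross (f x) (g x) : R).
Proof.
move=> [f1 f2] [g1 g2] x; apply: cvgB; apply: cvgM.
- exact: f2. - exact: g1. - exact: f1. - exact: g2.
Qed.

Lemma near_gt (f : X -> R) x c : continuous f -> c < f x ->
  \forall y \near x, c < f y.
Proof. by move=> /(_ x) hf cx; exact: (cvgr_gt _ hf). Qed.

Lemma near_lt (f : X -> R) x c : continuous f -> f x < c ->
  \forall y \near x, f y < c.
Proof. by move=> /(_ x) hf cx; exact: (cvgr_lt _ hf). Qed.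

End Continuity.

Section Perturbation.
Variables (R : realType) (m : nat).
Local Notation C := R[i].

(** Rescaling brings each pair to norm 1, hence the whole point into the compact cube [-1, 1]^(4m).
    Every point of the cube has a neighbourhood on which all small [e] work, and compactness makes
    the bound on [e] uniform. *)
Lemma compact_perturbation (q : ('I_m -> C) -> ('I_m -> C) -> C) :
  (forall (X : topologicalType) (z w : 'I_m -> X -> C),
     (forall k, ccontinuous (z k)) -> (forall k, ccontinuous (w k)) ->
     ccontinuous (fun x => q (fun k => z k x) (fun k => w k x))) ->
  (forall (s z w : 'I_m -> C), q z w = 0 ->
     q (fun k => s k * z k) (fun k => s k * w k) = 0) ->
  (forall z w, (forall k, 0 < sqnorm (z k) + sqnorm (w k)) ->
     (forall k, cross (z k) (w k) <= 0) -> q z w != 0) ->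
  exists2 e : R, 0 < e & forall z w,
    (forall k, 0 < sqnorm (z k) + sqnorm (w k)) ->
    (forall k, cross (z k) (w k) <= e * (sqnorm (z k) + sqnorm (w k))) -> q z w != 0.
Proof.
move=> qcont qscale qnz.
pose I : eqType := ('I_m * 'I_4)%type.
pose X : topologicalType := prod_topology (fun _ : I => R : topologicalType).
pose z (k : 'I_m) (x : X) : C := x (k, inord 0) +i* x (k, inord 1).
pose w (k : 'I_m) (x : X) : C := x (k, inord 2) +i* x (k, inord 3).
have zc k : ccontinuous (z k) by split; exact: proj_continuous.
have wc k : ccontinuous (w k) by split; exact: proj_continuous.
have qc := qcont _ _ _ zc wc.
pose nsq k x := sqnorm (z k x) + sqnorm (w k x).
have nsqc k : continuous (nsq k : X -> R).
  exact: (continuous_sqnormD (zc k) (wc k)).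
have crc k : continuous (fun x : X => cross (z k x) (w k x) : R).
  exact: (continuous_cross (zc k) (wc k)).
pose K : set X := [set f | forall i, `[-1, 1]%classic (f i)].
have Kc : compact K.
  apply: (@tychonoff I (fun=> R : topologicalType) (fun=> `[-1, 1]%classic)) => i.
  exact: segment_compact.
(* The first alternative discards the points of the cube with some pair of norm less than 1, (0, 0)
   included, by an open condition; normalized points do not satisfy it. *)
pose P (e : R) (x : X) := [\/ exists k, nsq k x < 1,
   q (fun k => z k x) (fun k => w k x) != 0 | exists k, e < cross (z k x) (w k x)].
have : \forall e \near 0^'+, K `<=` P e.
  have /compact_near_coveringP cov := Kc; apply: cov => x _.
  have [[k kx]|h1] := pselect (exists k, nsq k x < 1).
    exists ([set y | nsq k y < 1], setT).
      by split; [exact: (near_lt (nsqc k) kx)|exact: filterT].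
    by move=> [y e] /= [ky _]; apply: Or31; exists k.
  have [qx|/negP/negPn/eqP qx] := pselect (q (z^~ x) (w^~ x) != 0).
    exists ([set y | 0 < sqnorm (q (z^~ y) (w^~ y))], setT).
      split; last exact: filterT; apply: (near_gt (continuous_sqnorm qc)).
      by rewrite lt_neqAle sqnorm_ge0 eq_sym sqnorm_eq0 qx.
    move=> [y e] /= [qy _]; apply: Or32; rewrite -sqnorm_eq0.
    by move: qy; rewrite lt_neqAle eq_sym => /andP[].
  have [k kx] : exists k, 0 < cross (z k x) (w k x).
    apply: contrapT => /forallNP h; suff : q (z^~ x) (w^~ x) != 0 by rewrite qx eqxx.
    apply: qnz => k.
      apply: lt_le_trans ltr01 _; rewrite leNgt; apply/negP => lt.
      by apply: h1; exists k.
    by rewrite leNgt; apply/negP/h.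
  (* Half of the positive value at [x] separates [e] from the values of [cross] near [x]. *)
  exists ([set y | cross (z k x) (w k x) / 2 < cross (z k y) (w k y)],
    [set e | e < cross (z k x) (w k x) / 2]).
    split; first by apply: (near_gt (crc k)); rewrite ltr_pdivrMr // ltr_pMr // ltr1n.
    by apply: nbhs_right_lt; rewrite divr_gt0.
  by move=> [y e] /= [h1y h2y]; apply: Or33; exists k; exact: lt_trans h1y.
move=> hP; have [e [e0 KP]] : exists e : R, 0 < e /\ K `<=` P e.
  have : \forall e \near 0^'+, (0 : R) < e /\ K `<=` P e.
    by apply: filterI hP; exact: nbhs_right_gt.
  by move/filter_ex.
exists e => // z1 w1 nz1 cr1.
pose s k : R := (Num.sqrt (sqnorm (z1 k) + sqnorm (w1 k)))^-1.
have s2 k : s k ^+ 2 * (sqnorm (z1 k) + sqnorm (w1 k)) = 1.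
  by rewrite /s exprVn sqr_sqrtr ?ltW // mulVf // gt_eqF.
pose z2 k := (s k)%:C * z1 k; pose w2 k := (s k)%:C * w1 k.
have sqs k : sqnorm (s k)%:C = s k ^+ 2 by rewrite /sqnorm /= expr0n addr0.
have n2 k : sqnorm (z2 k) + sqnorm (w2 k) = 1 by rewrite !sqnormM -mulrDr sqs s2.
pose x : X := fun i : I => nth 0 [:: complex.Re (z2 i.1); complex.Im (z2 i.1);
   complex.Re (w2 i.1); complex.Im (w2 i.1)] i.2.
have zxk k : z k x = z2 k by rewrite /z /x /= !inordK //=; case: (z2 k).
have wxk k : w k x = w2 k by rewrite /w /x /= !inordK //=; case: (w2 k).
have zx : z^~ x = z2 by apply/funext.
have wx : w^~ x = w2 by apply/funext.
have Kx : K x.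
  have unit_itv (c : R) : c ^+ 2 <= 1 -> `[-1, 1]%classic c.
    move=> c1; rewrite /= in_itv /= -ler_norml -(@expr_le1 _ 2) //.
    by rewrite real_normK ?num_real.
  move=> [k i]; apply: unit_itv; rewrite -(n2 k) /sqnorm /x /=.
  have := (sqr_ge0 (complex.Re (z2 k)), sqr_ge0 (complex.Im (z2 k)),
           sqr_ge0 (complex.Re (w2 k)), sqr_ge0 (complex.Im (w2 k))).
  move=> [[[h1 h2] h3] h4].
  by case: i => -[|[|[|[|//]]]] _ /=; lra.
have := KP x Kx; case.
- move=> [k]; rewrite /nsq zxk wxk n2.
  by rewrite ltxx.
- rewrite zx wx => qx; apply: contra_neq qx; exact: qscale.
- move=> [k]; rewrite zxk wxk crossZ sqs.
  rewrite ltNge => /negP[]; rewrite -[X in _ <= X]mulr1 -(s2 k) mulrCA.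
  by rewrite ler_wpM2l ?sqr_ge0 // cr1.
Qed.
End Perturbation.

(** * The Riemann sphere and real polynomials *)

Section RiemannSphere.
Variable R : realType.
Local Notation C := R[i].
Local Notation Re := complex.Re.
Local Notation Im := complex.Im.
Implicit Types (z a b : C) (P : CP1 R).

Lemma nbhs_Im_gt (c : R) z : c < Im z -> nbhs (z : C^o) [set x : C | c < Im x].
Proof.
move=> cz; apply/nbhs_ballP; exists (Im z - c)%:C; first by rewrite /= ltcR subr_gt0.
move=> x; rewrite -ball_normE /= => zx.
have le : `|Im z - Im x|%:C <= `|(z : C) - x|.
  have := normc_ge_Re (((z : C) - x) * 'i); rewrite ReiNIm normrN normrM.
  rewrite [`|'i|]normc_def /= expr0n expr1n add0r sqrtr1 mulr1.
  by case: z x {cz zx} => [? ?] [? ?].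
by have := le_lt_trans le zx; rewrite ltcR ltr_norml => /andP[_]; lra.
Qed.

Lemma closure_lowerP P :
  closure (@lower_half_plane R) P <-> (if P is Some z then Im z <= 0 else True).
Proof.
case: P => [z|]; split => //.
- move=> cl; rewrite leNgt; apply/negP => z0.
  have [_ [[y /= y0 <-] [x /= x0 [xy]]]] :=
    cl _ (one_point_compactification_some_nbhs _ _ (nbhs_Im_gt z0)).
  by move: y0; rewrite -xy ltNge ltW.
- move=> z0 B /= /nbhs_ballP [e /= e0 eB].
  have eE : e = (Re e)%:C by rewrite RRe_real ?gtr0_real.
  have e0' : 0 < Re e by move: e0; rewrite eE ltcR.
  exists (Some (z - (0 +i* (Re e / 2)))); split.
    by exists (z - (0 +i* (Re e / 2))) => //=; case: z z0 {eB} => [a b] /=; lra.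
  apply: eB; rewrite -ball_normE /= opprB addrC subrK eE normc_def ltcR /=.
  by rewrite expr0n add0r sqrtr_sqr ger0_norm; lra.
(* A neighbourhood of infinity omits only a compact set of finite points. Their imaginary parts are
   bounded below, so a point far enough down the imaginary axis belongs to the neighbourhood. *)
move=> _ B [U [Uc _] UB].
have [n Un] : exists n : nat, U `<=` [set x | - n%:R < Im (x : C)].
  have /compact_near_coveringP cov := Uc.
  have : \forall n \near \oo, U `<=` [set x : C | - n%:R < Im x].
    apply: cov => x _.
    exists ([set y : C | Im x - 1 < Im y], [set n | - Im x + 1 < n%:R]).
      split; first by apply: nbhs_Im_gt; lra.
      exact: nbhs_infty_gtr.
    by move=> [y n] /= [h1 h2]; lra.
  by move/filter_ex.
exists (Some (0 +i* (- n.+1%:R))); split.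
  by exists (0 +i* (- n.+1%:R)) => //=; rewrite oppr_lt0 ltr0n.
apply: UB; left; exists (0 +i* (- n.+1%:R)) => // /Un /=.
by rewrite ltrN2 ltr_nat ltnNge leqnSn.
Qed.

(** With [hy], a section of [hpt]: stability becomes nonvanishing at one chosen representative of
    each point. *)
Definition hx P : C := if P is Some z then z else 1.
Definition hy P : C := if P is Some z then 1 else 0.

Lemma hxy_neq0 P : (hx P, hy P) != (0, 0).
Proof. by case: P => [z|]; rewrite xpair_eqE oner_eq0 ?andbF. Qed.

Lemma hpt_hxy P : hpt (hx P) (hy P) = P.
Proof. by case: P => [z|]; rewrite /hpt /= ?oner_eq0 ?eqxx // divr1. Qed.

Lemma stableP n (lam : 'X_{1..n}) (Omega : set ('I_n -> CP1 R)) (p : mhpoly C lam) :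
  stable Omega p <-> forall P : 'I_n -> CP1 R, Omega P ->
    (mhpoly_val p).@[fcat (fun k => hx (P k)) (fun k => hy (P k))] != 0.
Proof.
have zeroP (P : 'I_n -> CP1 R) : zero_at p P <->
    (mhpoly_val p).@[fcat (fun k => hx (P k)) (fun k => hy (P k))] = 0.
  have := @zero_at_hpt R _ _ p (fun k => hx (P k)) (fun k => hy (P k))
    (fun k => hxy_neq0 (P k)).
  by rewrite (_ : (fun k => hpt _ _) = P) //; apply/funext => k; exact: hpt_hxy.
split=> h P /h hP; first by apply/eqP => /zeroP.
by move=> /zeroP /eqP; apply/negP.
Qed.

Lemma stable_neq0 n (lam : 'X_{1..n}) (Omega : set ('I_n -> CP1 R)) (p : mhpoly C lam)
    (a b : 'I_n -> C) : stable Omega p -> (forall k, (a k, b k) != (0, 0)) ->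
  Omega (fun k => hpt (a k) (b k)) -> (mhpoly_val p).@[fcat a b] != 0.
Proof.
by move=> hp ab0 /hp hP; apply/eqP => h; apply: hP; apply/(zero_at_hpt _ ab0).
Qed.

Lemma Im_div a b : b != 0 -> Im (a / b) = cross a b / sqnorm b.
Proof.
rewrite -sqnorm_eq0 /cross /sqnorm; case: a b => [a1 a2] [b1 b2] /= b0.
by field.
Qed.

Lemma sqnorm_gt0 a : (0 < sqnorm a) = (a != 0).
Proof. by rewrite lt_neqAle sqnorm_ge0 andbT eq_sym sqnorm_eq0. Qed.

Lemma pair_neq0 a b : ((a, b) != (0, 0)) = (0 < sqnorm a + sqnorm b).
Proof.
rewrite lt_neqAle addr_ge0 ?sqnorm_ge0 // andbT [0 == _]eq_sym.
by rewrite paddr_eq0 ?sqnorm_ge0 // !sqnorm_eq0 xpair_eqE.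
Qed.

Lemma hpt_upper a b : 0 < cross a b -> upper_half_plane (hpt a b).
Proof.
move=> ab; have b0 : b != 0.
  by apply: contraTneq ab => ->; rewrite /cross !mulr0 subr0 ltxx.
rewrite /hpt (negbTE b0); exists (a / b) => //=.
by rewrite Im_div // divr_gt0 // sqnorm_gt0.
Qed.

Lemma hpt_closure_lower a b : cross a b <= 0 -> closure lower_half_plane (hpt a b).
Proof.
move=> ab; apply/closure_lowerP; rewrite /hpt; case: eqP => // /eqP b0.
by rewrite Im_div // pmulr_lle0 // invr_gt0 sqnorm_gt0.
Qed.

End RiemannSphere.

(** * Real coefficients and conjugation *)

Section RealPolynomials.
Variables (R : realType).
Local Notation C := R[i].

Lemma conjE (c : C) : Num.conj c = conjc c. Proof. by []. Qed.

Lemma meval_conj n (p : {mpoly C[n]}) v : p \is a mpolyOver n Num.real ->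
  p.@[fun i => conjc (v i)] = conjc p.@[v].
Proof.
move=> /mpolyOverP hp; rewrite !mevalE rmorph_sum /=; apply: eq_bigr => mu _.
rewrite rmorphM rmorph_prod /=; congr (_ * _).
  by rewrite -conjE (CrealP (hp mu)).
by apply: eq_bigr => i _; rewrite rmorphXn.
Qed.

Lemma meval_conj_affine l (p : {mpoly C[l + l]}) (X : 'I_l -> C) :
  p \is a mpolyOver (l + l) Num.real ->
  p.@[fcat (fun j => conjc (X j)) (fun=> 1)] = conjc p.@[fcat X (fun=> 1)].
Proof.
move=> /meval_conj <-; apply: meval_eq => i.
by rewrite /fcat; case: split => // _; rewrite conjc1.
Qed.

Lemma is_real_sum m (lam : 'X_{1..m}) (c : 'X_{1..m} -> C) :
  (forall mu, c mu \is Num.real) ->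
  is_real (\sum_(mu : 'X_{1..m < (mdeg lam).+1} | (mu <= lam)%MM)
             c mu *: xymon C lam mu).
Proof.
move=> hc; rewrite /is_real mhpoly_val_sum; apply/mpolyOverP => nu.
rewrite raddf_sum /=; apply: rpred_sum => mu le.
by rewrite xymonX // mcoeffZ mcoeffX rpredM // ?hc // realn.
Qed.

Lemma is_real_xymon m (lam mu : 'X_{1..m}) : (mu <= lam)%MM -> is_real (xymon C lam mu).
Proof.
by move=> le; rewrite /is_real xymonX //; apply/mpolyOverP => nu; rewrite mcoeffX realn.
Qed.

Lemma power_coef_conj_real m (lam mu : 'X_{1..m}) (z : 'I_m -> C) (om : 'I_m -> R) :
  power_coef lam (fun k => conjc (z k)) (fun k => (om k)%:C) mu =
  conjc (power_coef lam z (fun k => (om k)%:C) mu).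
Proof.
rewrite rmorph_prod; apply: eq_bigr => k _.
rewrite !rmorphM !rmorphXn rmorphN rmorph_nat.
by rewrite -[in LHS](conjc_real (om k)).
Qed.

Lemma is_real_combination m (lam : 'X_{1..m}) (c c' : 'X_{1..m} -> C) (u : C) :
  (forall mu, c' mu = conjc (c mu)) ->
  is_real (u *: (\sum_(mu : 'X_{1..m < (mdeg lam).+1} | (mu <= lam)%MM)
                   c mu *: xymon C lam mu) +
           conjc u *: (\sum_(mu : 'X_{1..m < (mdeg lam).+1} | (mu <= lam)%MM)
                   c' mu *: xymon C lam mu)).
Proof.
move=> cc'; rewrite !scaler_sumr -big_split /=.
rewrite (eq_bigr (fun mu : 'X_{1..m < _} =>
  (u * c mu + conjc u * c' mu) *: xymon C lam mu)) => [|mu _]; last first.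
  by rewrite scalerDl !scalerA.
apply: (@is_real_sum m lam (fun mu => u * c mu + conjc u * c' mu)) => mu.
by rewrite cc' -rmorphM CrealE conjE rmorphD /= conjcK addrC.
Qed.

End RealPolynomials.

(** * The characterization *)

Section Characterization.
Variables (R : realType) (m l : nat) (lam : 'X_{1..m}) (al : 'X_{1..l}).
Local Notation C := R[i].
Local Notation Re := complex.Re.
Local Notation Im := complex.Im.
Variable T : {linear mhpoly C lam -> mhpoly C al}.

Definition symbol_at (z w : 'I_m -> C) (X Y : 'I_l -> C) : C :=
  (mhpoly_val (T (linear_power lam z w))).@[fcat X Y].

Lemma symbol_atE z w X Y : symbol_at z w X Y =
  \sum_(mu : 'X_{1..m < (mdeg lam).+1} | (mu <= lam)%MM)
    power_coef lam z w mu * (mhpoly_val (T (xymon C lam mu))).@[fcat X Y].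
Proof. exact: meval_image_sum. Qed.

Lemma Symb_symbol_at z w X Y :
  (mhpoly_val (Symb T)).@[fcat (fcat z X) (fcat w Y)] = symbol_at z w X Y.
Proof.
rewrite meval_Symb /symbol_at.
have fl (A : Type) p q (f : 'I_p -> A) (g : 'I_q -> A) :
    (fun k => fcat f g (lshift q k)) = f.
  by apply/funext => k; exact: fcat_lshift.
have fr (A : Type) p q (f : 'I_p -> A) (g : 'I_q -> A) :
    (fun k => fcat f g (rshift p k)) = g.
  by apply/funext => k; exact: fcat_rshift.
by rewrite !fl !fr.
Qed.

(** * From the symbol to the operator *)

Section SymbolToOperator.
Variable B : set (CP1 R).
Hypothesis symb_stable : stable (set_pow2 (closure lower_half_plane) B) (Symb T).
Variables X Y : 'I_l -> C.
Hypotheses (XY0 : forall j, (X j, Y j) != (0, 0)) (XYB : forall j, B (hpt (X j) (Y j))).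

Lemma symbol_at_neq0 z w : (forall k, 0 < sqnorm (z k) + sqnorm (w k)) ->
  (forall k, cross (z k) (w k) <= 0) -> symbol_at z w X Y != 0.
Proof.
move=> zw0 zw; rewrite -Symb_symbol_at; apply: stable_neq0 symb_stable _ _ => [k|].
  by case: (split_ordP k) => j ->; rewrite ?(fcat_lshift, fcat_rshift) // pair_neq0.
split=> k; rewrite ?(fcat_lshift, fcat_rshift) //; exact: hpt_closure_lower.
Qed.

Lemma symbol_atZ s z w :
  symbol_at (fun k => s k * z k) (fun k => s k * w k) X Y =
  \prod_k s k ^+ lam k * symbol_at z w X Y.
Proof.
rewrite !symbol_atE mulr_sumr; apply: eq_bigr => mu /mnm_lepP le.
rewrite mulrA; congr (_ * _); rewrite -big_split; apply: eq_bigr => k _ /=.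
rewrite -mulrN !exprMn; set W := (- w k) ^+ _.
have -> : s k ^+ lam k = s k ^+ (lam k - mu k) * s k ^+ mu k by rewrite -exprD subnK.
ring.
Qed.

(** Compactness extends the zero-free region of the symbol past the closed lower half-planes, so
    that it and the zero-free region of [p] contain complementary closed disks, as Grace's theorem
    requires. *)
Lemma operator_neq0 (p : mhpoly C lam) : stable (set_pow upper_half_plane) p ->
  (mhpoly_val (T p)).@[fcat X Y] != 0.
Proof.
move=> hp; rewrite (mhpoly_expand p) meval_image_sum.
have [|||e e0 he] := @compact_perturbation R m (fun z w => symbol_at z w X Y).
- move=> S z w hz hw; under eq_fun do rewrite symbol_atE.
  apply: ccontinuous_sum => mu; apply: ccontinuousM; last exact: ccontinuous_cst.
  exact: ccontinuous_power_coef.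
- by move=> s z w zw; rewrite symbol_atZ zw mulr0.
- exact: symbol_at_neq0.
(* At the point (i e : 1), [cross] is [e] and the squared norm is [1 + e ^+ 2]: with this [e'] the
   point lies on the common boundary circle, and [e' <= e] keeps the outer disk in the zero-free
   region of the symbol. *)
pose e' := e / (1 + e ^+ 2).
have e1 : 1 <= 1 + e ^+ 2 by rewrite lerDl sqr_ge0.
have e'0 : 0 < e' by rewrite divr_gt0 // (lt_le_trans ltr01).
have e'e : e' <= e by rewrite ler_pdivrMr ?(lt_le_trans ltr01) // ler_peMr // ltW.
have c0 : herm (- e')%:C (0 +i* (- 2^-1)) (- e')%:C (0 +i* e) 1 = 0.
  rewrite herm_cross /cross /sqnorm /=; congr (_ %:C).
  by rewrite /e'; field; rewrite gt_eqF // (lt_le_trans ltr01).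
have eR : (- e')%:C \is Num.real by apply/complex_realP; exists (- e').
have diskP x y : in_disk (- e')%:C (0 +i* (- 2^-1)) (- e')%:C x y =
    (0 < sqnorm x + sqnorm y) && (e' * (sqnorm x + sqnorm y) <= cross x y).
  rewrite /in_disk herm_cross lecR subr_ge0 -pair_neq0 xpair_eqE negb_and //.
have odiskP x y : out_disk (- e')%:C (0 +i* (- 2^-1)) (- e')%:C x y =
    (0 < sqnorm x + sqnorm y) && (cross x y <= e' * (sqnorm x + sqnorm y)).
  by rewrite out_diskE herm_cross lecR subr_le0 -pair_neq0 xpair_eqE negb_and.
apply: (grace_mhpoly (t := fun mu => (mhpoly_val (T (xymon C lam mu))).@[fcat X Y])
  (be := 0 +i* (- 2^-1)) (c1 := 0 +i* e) (c2 := 1) eR eR).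
- by rewrite /in_disk c0 oner_eq0 orbT lexx.
- by rewrite out_diskE c0 oner_eq0 orbT lexx.
- move=> x y hxy; apply: stable_neq0 hp _ _ => k; have := hxy k; rewrite diskP.
    by rewrite pair_neq0 => /andP[].
  move=> /andP[n0 h]; apply/hpt_upper/(lt_le_trans _ h); exact: mulr_gt0.
move=> z w hzw; rewrite -symbol_atE; apply: he => k; have := hzw k; rewrite odiskP.
  by case/andP.
by move=> /andP[n0 /le_trans]; apply; rewrite ler_pM2r.
Qed.

End SymbolToOperator.

(** * From the operator to the symbol *)

Section OperatorToSymbol.
Hypothesis T_real : forall p : mhpoly C lam, is_real p -> is_real (T p).
Hypothesis T_stable : forall p : mhpoly C lam,
  real_stable p -> T p != 0 /\ real_stable (T p).

Local Notation toC om := (fun k => (om k)%:C).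
Local Notation conjf z := (fun k => conjc (z k)).
Local Notation one := (fun=> 1).
Implicit Types (z : 'I_m -> C) (om : 'I_m -> R) (X : 'I_l -> C).

(* Homogeneous coordinates (z : om) with om real, which makes the condition convex. *)
Definition closed_lower (z : 'I_m -> C) (om : 'I_m -> R) :=
  forall k, [/\ 0 <= om k, Im (z k) <= 0 & om k = 0 -> z k != 0].

Lemma linear_factor_neq0 z om k x : closed_lower z om -> 0 < Im x ->
  z k - x * (om k)%:C != 0.
Proof.
move=> /(_ k) [om0 z0 zom] x0; have [e|ne] := eqVneq (om k) 0.
  by rewrite e mulr0 subr0 zom.
have om1 : 0 < om k by rewrite lt_neqAle eq_sym ne.
apply/eqP => /(congr1 (@complex.Im R)); have := mulr_gt0 x0 om1.
by case: (z k) x z0 {x0 zom} => [a b] [c d] /=; lra.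
Qed.

(** The squared moduli differ by -4 om Im(z) Im(x), which is nonnegative: for om > 0, a point of the
    upper half-plane is at least as close to the conjugate of z/om as to z/om. *)
Lemma linear_factor_le z om k x : closed_lower z om -> 0 < Im x ->
  sqnorm (conjc (z k) - x * (om k)%:C) <= sqnorm (z k - x * (om k)%:C).
Proof.
move=> /(_ k) [om0 z0 _] x0; rewrite /sqnorm.
case: (z k) x z0 x0 => [a b] [c d] /= b0 d0.
have : 0 <= - b * (d * om k) by rewrite mulr_ge0 ?oppr_ge0 // mulr_ge0 // ltW.
nra.
Qed.

Lemma linear_factor_lt z om k x : 0 < om k -> Im (z k) < 0 -> 0 < Im x ->
  sqnorm (conjc (z k) - x * (om k)%:C) < sqnorm (z k - x * (om k)%:C).
Proof.
move=> om0 z0 x0; rewrite /sqnorm.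
case: (z k) x z0 x0 => [a b] [c d] /= b0 d0.
have : 0 < - b * (d * om k) by rewrite mulr_gt0 ?oppr_gt0 // mulr_gt0.
nra.
Qed.

Lemma linear_power_upper_neq0 z om x : closed_lower z om ->
  (forall k, 0 < Im (x k)) ->
  (mhpoly_val (linear_power lam z (toC om))).@[fcat x one] != 0.
Proof.
move=> zom x0; rewrite linear_powerE; apply/prodf_neq0 => k _.
by rewrite mulr1 expf_neq0 // linear_factor_neq0.
Qed.

Lemma sqnorm_prod (I : Type) (r : seq I) (P : pred I) (f : I -> C) :
  sqnorm (\prod_(i <- r | P i) f i) = \prod_(i <- r | P i) sqnorm (f i).
Proof.
apply: (big_morph (@sqnorm R)); first exact: sqnormM.
by rewrite /sqnorm /= expr1n expr0n addr0.
Qed.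

Lemma sqnormX (x : C) n : sqnorm (x ^+ n) = sqnorm x ^+ n.
Proof.
elim: n => [|n ih]; first by rewrite !expr0 /sqnorm /= expr1n expr0n addr0.
by rewrite !exprS sqnormM ih.
Qed.

Lemma sqnorm_linear_power (z w x : 'I_m -> C) :
  sqnorm (mhpoly_val (linear_power lam z w)).@[fcat x one] =
  \prod_k sqnorm (z k - x k * w k) ^+ lam k.
Proof.
rewrite linear_powerE sqnorm_prod; apply: eq_bigr => k _.
by rewrite mulr1 sqnormX.
Qed.

(** Factorwise comparison; the factor [k] is strict and occurs with positive exponent, and the
    remaining factors of the larger product are nonzero. *)
Lemma linear_power_conj_lt z om x k : closed_lower z om ->
  (0 < lam k)%N -> 0 < om k -> Im (z k) < 0 -> (forall k, 0 < Im (x k)) ->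
  sqnorm (mhpoly_val (linear_power lam (conjf z) (toC om))).@[fcat x one] <
  sqnorm (mhpoly_val (linear_power lam z (toC om))).@[fcat x one].
Proof.
move=> zom lk omk zk x0.
have lt_eqs (A A' B B' : R) : A = A' -> B = B' -> A' < B' -> A < B by move=> -> ->.
apply: (lt_eqs _ _ _ _ (sqnorm_linear_power _ _ _) (sqnorm_linear_power _ _ _)).
rewrite (bigD1 k) //= [ltRHS](bigD1 k) //=.
have pos j : 0 < sqnorm (z j - x j * (om j)%:C) ^+ lam j.
  by rewrite exprn_gt0 // sqnorm_gt0 linear_factor_neq0.
apply: (@le_lt_trans _ _ (sqnorm (conjc (z k) - x k * (om k)%:C) ^+ lam k *
   \prod_(j | j != k) sqnorm (z j - x j * (om j)%:C) ^+ lam j)).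
  rewrite ler_wpM2l ?exprn_ge0 ?sqnorm_ge0 // ler_prod // => j _.
  by rewrite exprn_ge0 ?sqnorm_ge0 // lerXn2r ?nnegrE ?sqnorm_ge0 // linear_factor_le.
rewrite ltr_pM2r ?prodr_gt0 // ltrXn2r ?sqnorm_ge0 -?lt0n //.
exact: linear_factor_lt.
Qed.

Lemma real_stable_image_neq0 (p : mhpoly C lam) (X : 'I_l -> C) : is_real p ->
  (forall x : 'I_m -> C, (forall k, 0 < Im (x k)) ->
     (mhpoly_val p).@[fcat x one] != 0) ->
  (forall j, 0 < Im (X j)) -> (mhpoly_val (T p)).@[fcat X one] != 0.
Proof.
move=> preal pnz X0; have pst : real_stable p.
  split=> //; apply/stableP => P hP.
  pose x k := hx (P k); have x0 k : 0 < Im (x k).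
    by rewrite /x; have [z /= z0 <-] := hP k.
  rewrite (_ : (fun k => hy (P k)) = one) ?pnz //.
  by apply/funext => k; have [z _ <-] := hP k.
have [_ [_ st]] := T_stable pst.
apply: stable_neq0 st _ _ => j; first by rewrite xpair_eqE oner_eq0 andbF.
by apply: hpt_upper; rewrite /cross /= mulr1 mulr0 subr0.
Qed.

(** A square root u of -B/A has modulus 1, so u times the combination is u^2 A + B = 0. *)
Lemma sqnorm_unitary (A B : C) : sqnorm A = sqnorm B ->
  exists2 u : C, u != 0 & u * A + conjc u * B = 0.
Proof.
have [->|A0] := eqVneq A 0.
  have -> : sqnorm (0 : C) = 0 by rewrite /sqnorm /= expr0n addr0.
  move=> /esym/eqP; rewrite sqnorm_eq0 => /eqP ->.
  by exists 1; rewrite ?oner_eq0 // !mulr0 addr0.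
move=> AB; have B0 : B != 0 by rewrite -sqnorm_eq0 -AB sqnorm_eq0.
pose u := sqrtc (- B / A); have u2 : u ^+ 2 = - B / A by exact: sqr_sqrtc.
have u0 : u != 0.
  have : u ^+ 2 != 0 by rewrite u2 mulf_eq0 oppr_eq0 invr_eq0 negb_or B0.
  by rewrite expf_eq0.
exists u => //; apply: (mulfI u0); rewrite mulr0 mulrDr !mulrA -expr2 u2.
have -> : u * conjc u = 1; last by rewrite mul1r mulfVK // addNr.
have sqE (c : C) : c * conjc c = (sqnorm c)%:C.
  by case: c => [a b]; apply/eqP; rewrite /sqnorm eq_complex /=;
    apply/andP; split; apply/eqP; ring.
have s2 : sqnorm u ^+ 2 = 1.
  have : sqnorm A * sqnorm u ^+ 2 = sqnorm A * 1.
    rewrite -sqnormX -sqnormM u2 mulrC mulfVK // mulr1 AB -mulN1r sqnormM.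
    by rewrite [sqnorm (- 1)]/sqnorm /= oppr0 expr0n addr0 sqrrN expr1n mul1r.
  by apply: mulfI; rewrite sqnorm_eq0.
rewrite sqE; congr (_ %:C); apply/eqP; rewrite -(@eqrXn2 _ 2) ?sqnorm_ge0 //.
by rewrite s2 expr1n.
Qed.

(* If the two moduli agreed, some nonzero combination u f + u^* f' would be sent
   by T to a polynomial vanishing at X. *)
Lemma sqnorm_image_neq (f f' : mhpoly C lam) X :
  (forall u, is_real (u *: f + conjc u *: f')) ->
  (forall x : 'I_m -> C, (forall k, 0 < Im (x k)) ->
     sqnorm (mhpoly_val f').@[fcat x one] < sqnorm (mhpoly_val f).@[fcat x one]) ->
  (forall j, 0 < Im (X j)) ->
  sqnorm (mhpoly_val (T f)).@[fcat X one] != sqnorm (mhpoly_val (T f')).@[fcat X one].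
Proof.
move=> freal flt X0; apply/eqP => /sqnorm_unitary [u u0 uS].
have /negP[] : (mhpoly_val (T (u *: f + conjc u *: f'))).@[fcat X one] != 0.
  apply: real_stable_image_neq0 => // x x0.
  rewrite meval_mhlin; apply/negP; rewrite addr_eq0 => /eqP /(congr1 (@sqnorm R)).
  rewrite -mulNr !sqnormM; apply/eqP.
  have -> : sqnorm (- conjc u) = sqnorm u.
    by case: (u) => [a b]; rewrite /sqnorm /= opprK sqrrN.
  by rewrite (inj_eq (mulfI _)) ?sqnorm_eq0 // gt_eqF // flt.
by rewrite linearD !linearZ meval_mhlin uS.
Qed.

(** If positive, the symbol is nonzero at (z, X); if negative, it is nonzero at (conj z, X), hence
    by conjugation at (z, conj X). Its sign thus selects the half-plane for the output variables. *)
Definition sqnorm_gap z om X : R :=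
  sqnorm (symbol_at z (toC om) X one) - sqnorm (symbol_at (conjf z) (toC om) X one).

Lemma sqnorm_gap_neq0 z om X k : closed_lower z om ->
  (0 < lam k)%N -> 0 < om k -> Im (z k) < 0 -> (forall j, 0 < Im (X j)) ->
  sqnorm_gap z om X != 0.
Proof.
move=> zom lk omk zk X0; rewrite /sqnorm_gap subr_eq0.
apply: sqnorm_image_neq X0 => [u|x x0]; last exact: (linear_power_conj_lt zom lk).
apply: is_real_combination => mu; exact: power_coef_conj_real.
Qed.

Lemma symbol_at_conj z om X :
  symbol_at (conjf z) (toC om) (conjf X) one = conjc (symbol_at z (toC om) X one).
Proof.
rewrite [LHS]symbol_atE [in RHS]symbol_atE rmorph_sum; apply: eq_bigr => mu le.
rewrite rmorphM /= power_coef_conj_real; congr (_ * _).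
exact: (meval_conj_affine X (T_real (is_real_xymon R le))).
Qed.

(** The degenerate case, where the gap gives no information: the product of powers of linear forms
    is itself real stable, so its image is nonzero on both products of half-planes. *)
Lemma real_coords_symbol_neq0 z om X : closed_lower z om ->
  (forall k, lam k = 0%N \/ Im (z k) = 0) -> (forall j, 0 < Im (X j)) ->
  symbol_at z (toC om) X one != 0 /\ symbol_at z (toC om) (conjf X) one != 0.
Proof.
move=> zom zreal X0; have fr : is_real (linear_power lam z (toC om)).
  apply: is_real_sum => mu; apply: rpred_prod => k _.
  have omR : (om k)%:C \is Num.real by apply/complex_realP; exists (om k).
  apply: rpredM; first exact: realn.
  case: (zreal k) => [->|zk]; first by rewrite sub0n expr0 mul1r rpredX // rpredN.
  apply: rpredM; apply: rpredX; last by rewrite rpredN.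
  by apply/complex_realP; exists (Re (z k)); case: (z k) zk => a b /= ->.
have nz : symbol_at z (toC om) X one != 0.
  by apply: real_stable_image_neq0 => // x x0; exact: linear_power_upper_neq0.
split=> //; rewrite /symbol_at (meval_conj_affine X (T_real fr)) conjc_eq0.
exact: nz.
Qed.

Lemma ccontinuous_symbol_at (S : topologicalType) (z w : 'I_m -> S -> C)
    (X Y : 'I_l -> S -> C) :
  (forall k, ccontinuous (z k)) -> (forall k, ccontinuous (w k)) ->
  (forall j, ccontinuous (X j)) -> (forall j, ccontinuous (Y j)) ->
  ccontinuous (fun s => symbol_at (z^~ s) (w^~ s) (X^~ s) (Y^~ s)).
Proof.
move=> hz hw hX hY; under eq_fun do rewrite symbol_atE.
apply: ccontinuous_sum => mu; apply: ccontinuousM; first exact: ccontinuous_power_coef.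
apply: (@ccontinuous_meval _ _ _ _ (fun i s => fcat (X^~ s) (Y^~ s) i)) => i.
by rewrite /fcat; case: split.
Qed.

Lemma ccontinuous_real (S : topologicalType) (f : S -> R) :
  continuous f -> ccontinuous (fun s => (f s)%:C).
Proof. by move=> hf; split=> //=; exact: cst_continuous. Qed.

Lemma ccontinuous_conj (S : topologicalType) (f : S -> C) :
  ccontinuous f -> ccontinuous (fun s => conjc (f s)).
Proof.
move=> [f1 f2]; split.
  by rewrite (_ : (fun s => _) = fun s => Re (f s)) //; apply/funext => s; case: (f s).
rewrite (_ : (fun s => _) = fun s => - Im (f s)); last first.
  by apply/funext => s; case: (f s).
by move=> s; apply: cvgN; exact: f2.
Qed.

Definition base_gap := sqnorm_gap (fun=> 0 -i* 1) (fun=> 1) (fun=> 0 +i* 1).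

(* The gap does not vanish on the segment from the given point to the base
   point. *)
Lemma sqnorm_gap_sign z om X k : closed_lower z om ->
  (0 < lam k)%N -> 0 < om k -> Im (z k) < 0 -> (forall j, 0 < Im (X j)) ->
  0 < base_gap * sqnorm_gap z om X.
Proof.
move=> zom lk omk zk X0.
pose cz j (t : R) : C := (1 - t)%:C * z j + t%:C * (0 -i* 1).
pose co j (t : R) : R := (1 - t) * om j + t.
pose cX j (t : R) : C := (1 - t)%:C * X j + t%:C * (0 +i* 1).
pose f t := sqnorm_gap (cz^~ t) (co^~ t) (cX^~ t).
have z0 : cz^~ 0 = z.
  by apply/funext => j; rewrite /cz subr0 mul0r addr0 mul1r.
have o0 : co^~ 0 = om by apply/funext => j; rewrite /co subr0 mul1r addr0.
have x0 : cX^~ 0 = X.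
  by apply/funext => j; rewrite /cX subr0 mul0r addr0 mul1r.
have z1 : cz^~ 1 = fun=> 0 -i* 1.
  by apply/funext => j; rewrite /cz subrr mul0r add0r mul1r.
have o1 : co^~ 1 = fun=> 1 by apply/funext => j; rewrite /co subrr mul0r add0r.
have x1 : cX^~ 1 = fun=> 0 +i* 1.
  by apply/funext => j; rewrite /cX subrr mul0r add0r mul1r.
have f0 : f 0 = sqnorm_gap z om X by rewrite /f z0 o0 x0.
have f1 : f 1 = base_gap by rewrite /f z1 o1 x1.
have tc : continuous (fun t : R => 1 - t).
  by move=> t; apply: cvgB; [exact: cvg_cst|exact: cvg_id].
have idc : continuous (fun t : R => t) by move=> t; exact: cvg_id.
have czc j : ccontinuous (cz j).
  by apply: ccontinuousD; apply: ccontinuousM;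
    [exact: ccontinuous_real|exact: ccontinuous_cst|
     exact: ccontinuous_real|exact: ccontinuous_cst].
have cXc j : ccontinuous (cX j).
  by apply: ccontinuousD; apply: ccontinuousM;
    [exact: ccontinuous_real|exact: ccontinuous_cst|
     exact: ccontinuous_real|exact: ccontinuous_cst].
have coc j : ccontinuous (fun t => (co j t)%:C).
  apply: ccontinuous_real => t; apply: cvgD; last exact: cvg_id.
  by apply: cvgM; [exact: tc|exact: cvg_cst].
have onec (j : 'I_l) : ccontinuous (fun _ : R => 1 : C) by exact: ccontinuous_cst.
have fc : continuous f.
  have h1 := continuous_sqnorm (ccontinuous_symbol_at czc coc cXc onec).
  have h2 := continuous_sqnorm (ccontinuous_symbol_at
    (fun j => ccontinuous_conj (czc j)) coc cXc onec).
  by move=> t; apply: cvgB; [exact: h1|exact: h2].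
have fn0 t : 0 <= t <= 1 -> f t != 0.
  case/andP => t0 t1; rewrite /f.
  apply: (@sqnorm_gap_neq0 (cz^~ t) (co^~ t) (cX^~ t) k _ lk).
  - move=> j; have [om0 zj0 omz] := zom j; split.
    + by rewrite /co addr_ge0 // mulr_ge0 // subr_ge0.
    + rewrite /cz; case: (z j) zj0 => a b /= b0.
      have : 0 <= (1 - t) * - b by rewrite mulr_ge0 ?subr_ge0 ?oppr_ge0.
      lra.
    (* For [t] > 0 the coordinate [co j t] is positive, so the condition at infinity is vacuous. *)
    + rewrite /co /cz; have [->|tn] := eqVneq t 0.
        by rewrite !subr0 !mul1r mul0r !addr0.
      have tp : 0 < t by rewrite lt_neqAle eq_sym tn.
      have : 0 <= (1 - t) * om j by rewrite mulr_ge0 // subr_ge0.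
      by move=> h e; exfalso; move: e; apply/eqP; rewrite gt_eqF // ltr_wpDl.
  - rewrite /co; have : 0 <= (1 - t) * om k by rewrite mulr_ge0 ?subr_ge0 // ltW.
    have [->|tn] := eqVneq t 0; first by rewrite subr0 mul1r addr0.
    by move=> h; rewrite ltr_wpDl // lt_neqAle eq_sym tn.
  - rewrite /cz; case: (z k) zk => a b /= b0; nra.
  - move=> j; have := X0 j; rewrite /cX; case: (X j) => a b /= b0; nra.
rewrite -f0 -f1 ltNge; apply/negP => fle.
have [c c01 fc0] : exists2 c : R, c \in `[0, 1]%R & f c = 0.
  apply: IVT => //; first exact: continuous_subspaceT.
  by rewrite ge_min le_max; nra.
by move/eqP: fc0; apply/negP/fn0; move: c01; rewrite in_itv.
Qed.

End OperatorToSymbol.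
End Characterization.

(** * Translation to points of the sphere and the two implications *)

Section Assembly.
Variables (R : realType) (m l : nat) (lam : 'X_{1..m}) (al : 'X_{1..l}).
Local Notation C := R[i].
Local Notation Im := complex.Im.
Variable T : {linear mhpoly C lam -> mhpoly C al}.
Hypothesis T_real : forall p : mhpoly C lam, is_real p -> is_real (T p).
Implicit Types P : 'I_(m + l) -> CP1 R.

(** If the symbol is stable for the lower half-planes in the output, [operator_neq0] is applied at
    the conjugate point, and the reality of the image of [p] brings the result back. *)
Lemma operator_preserves (p : mhpoly C lam) :
  stable (set_pow2 (closure lower_half_plane) upper_half_plane) (Symb T) \/
  stable (set_pow2 (closure lower_half_plane) lower_half_plane) (Symb T) ->
  real_stable p -> T p != 0 /\ real_stable (T p).
Proof.
move=> symb [preal pst].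
have nz (X : 'I_l -> C) : (forall j, 0 < Im (X j)) ->
    (mhpoly_val (T p)).@[fcat X (fun=> 1)] != 0.
  move=> X0; have XY0 (X' : 'I_l -> C) j : (X' j, 1 : C) != (0, 0).
    by rewrite xpair_eqE oner_eq0 andbF.
  case: symb => symb.
    apply: (operator_neq0 symb (XY0 X)) pst => j.
    by apply: hpt_upper; rewrite /cross /= mulr1 mulr0 subr0.
  rewrite -conjc_eq0 -(meval_conj_affine X (T_real preal)).
  apply: (operator_neq0 symb (XY0 (fun j => conjc (X j)))) pst => j.
  exists (conjc (X j)); last by rewrite /hpt oner_eq0 divr1.
  by have := X0 j; case: (X j) => a b /=; rewrite oppr_lt0.
split; last first.
  split; first exact: T_real.
  apply/stableP => P hP; rewrite (_ : (fun k => hy (P k)) = fun=> 1).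
    by apply: nz => j; have [z /= z0 <-] := hP j.
  by apply/funext => j; have [z _ <-] := hP j.
apply/eqP => Tp0; have := nz (fun=> 0 +i* 1) (fun=> ltr01).
by rewrite Tp0 meval0 eqxx.
Qed.

Definition hy_real (P : CP1 R) : R := if P is Some z then 1 else 0.

Lemma closed_lower_coords P (B : set (CP1 R)) :
  set_pow2 (closure lower_half_plane) B P ->
  closed_lower (fun k => hx (P (lshift l k))) (fun k => hy_real (P (lshift l k))).
Proof.
move=> [hP _] k; have /closure_lowerP := hP k.
case: (P _) => [z|] /= z0; split=> //; first by move/eqP; rewrite oner_eq0.
by move=> _; rewrite oner_eq0.
Qed.

(** Either the strict comparison of moduli is available, or every coordinate of positive degree is
    real; infinity counts as real, its representative being (1 : 0). *)
Lemma coords_cases P (B : set (CP1 R)) :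
  set_pow2 (closure lower_half_plane) B P ->
  (exists k, [/\ (0 < lam k)%N, 0 < hy_real (P (lshift l k)) &
                 Im (hx (P (lshift l k))) < 0]) \/
  (forall k, lam k = 0%N \/ Im (hx (P (lshift l k))) = 0).
Proof.
move=> [hP _]; have [h|h] := pselect (exists k, [/\ (0 < lam k)%N,
  0 < hy_real (P (lshift l k)) & Im (hx (P (lshift l k))) < 0]); [by left|right=> k].
have [l0|l0] := posnP (lam k); [by left|right].
have /closure_lowerP := hP k; case E: (P _) => [z|] //= z0.
apply/eqP; rewrite eq_le z0 leNgt; apply/negP => z0'; apply: h; exists k.
by rewrite E /=; split.
Qed.

Lemma meval_Symb_coords P :
  (mhpoly_val (Symb T)).@[fcat (fun k => hx (P k)) (fun k => hy (P k))] =
  symbol_at T (fun k => hx (P (lshift l k))) (fun k => (hy_real (P (lshift l k)))%:C)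
    (fun j => hx (P (rshift m j))) (fun j => hy (P (rshift m j))).
Proof.
rewrite meval_Symb /symbol_at.
have -> : (fun k => hy (P (lshift l k))) = fun k => (hy_real (P (lshift l k)))%:C.
  by apply/funext => k; rewrite /hy_real; case: (P _).
by [].
Qed.

Hypothesis T_stable : forall p : mhpoly C lam,
  real_stable p -> T p != 0 /\ real_stable (T p).

Lemma symbol_stable :
  stable (set_pow2 (closure lower_half_plane) upper_half_plane) (Symb T) \/
  stable (set_pow2 (closure lower_half_plane) lower_half_plane) (Symb T).
Proof.
have := @sqnorm_gap_sign R m l lam al T T_stable; set g := base_gap _ => gap_sign.
(* The value [g = 0] may go to either side: a point with a strict coordinate excludes it, and at all
   other points the degenerate case gives both conclusions. *)
have [g0|g0] := ltP g 0; [right|left]; apply/stableP => P hP;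
  rewrite meval_Symb_coords; have zom := closed_lower_coords hP.
- have -> : (fun j => hy (P (rshift m j))) = fun=> 1.
    by apply/funext => j; have [z _ <-] := hP.2 j.
  pose X j := hx (P (rshift m j)).
  have X0 j : 0 < Im (conjc (X j)).
    by have [[a b] /= z0 e] := hP.2 j; rewrite /X -e /= oppr_gt0.
  rewrite -/X (_ : X = fun j => conjc (conjc (X j))); last first.
    by apply/funext => j; rewrite conjcK.
  have [[k [lk omk zk]]|deg] := coords_cases hP; last first.
    exact: (real_coords_symbol_neq0 T_real T_stable zom deg X0).2.
  (* Here [X] is in the lower half-planes. The gap at (z, conj X) is negative, so the symbol is
     nonzero at (conj z, conj X), and its conjugate there is the value at (z, X). *)
  have := gap_sign _ _ _ _ zom lk omk zk X0.
  rewrite nmulr_rgt0 // /sqnorm_gap subr_lt0 => lt.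
  have : symbol_at T (fun k => conjc (hx (P (lshift l k))))
     (fun k => (hy_real (P (lshift l k)))%:C) (fun j => conjc (X j)) (fun=> 1) != 0.
    by rewrite -sqnorm_gt0; apply: le_lt_trans lt; exact: sqnorm_ge0.
  rewrite -conjc_eq0 -(symbol_at_conj T_real).
  rewrite (_ : (fun k => conjc (conjc _)) = fun k => hx (P (lshift l k))) //.
  by apply/funext => k0; rewrite conjcK.
- have -> : (fun j => hy (P (rshift m j))) = fun=> 1.
    by apply/funext => j; have [z _ <-] := hP.2 j.
  have X0 j : 0 < Im (hx (P (rshift m j))).
    by have [z /= z0 <-] := hP.2 j.
  have [[k [lk omk zk]]|deg] := coords_cases hP; last first.
    exact: (real_coords_symbol_neq0 T_real T_stable zom deg X0).1.
  have gpos := gap_sign _ _ _ _ zom lk omk zk X0.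
  have g1 : 0 < g.
    rewrite lt_neqAle g0 andbT eq_sym.
    by apply: contraTneq gpos => ->; rewrite mul0r ltxx.
  move: gpos; rewrite pmulr_rgt0 // /sqnorm_gap subr_gt0 => lt.
  by rewrite -sqnorm_gt0; apply: le_lt_trans lt; exact: sqnorm_ge0.
Qed.

End Assembly.

Theorem theorem7p2 (R : realType) (m l : nat)
    (lam : 'X_{1..m}) (al : 'X_{1..l})
    (T : {linear mhpoly R[i] lam -> mhpoly R[i] al})
    (T_real : forall p : mhpoly R[i] lam, is_real p -> is_real (T p)) :
  (forall p : mhpoly R[i] lam,
      real_stable p -> T p != 0 /\ real_stable (T p))
  <->
  (stable (set_pow2 (closure lower_half_plane) upper_half_plane) (Symb T) \/
   stable (set_pow2 (closure lower_half_plane) lower_half_plane) (Symb T)).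
Proof.
split=> [T_stable|symb p]; first exact: symbol_stable.
exact: operator_preserves.
Qed.
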